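(* Let $(H(k))_{k\in\mathbb{Z}}$ and $(V(k))_{k\in\mathbb{Z}}$ be two independent families of i.i.d. positive random variables such that: (i) there exists $c>0$ with $H(x)\ge c$ and $V(x)\ge c$ for all $x\in\mathbb{Z}$; (ii) there exist exponents $\alpha_1,\alpha_2>0$ and constants $c_H,c_V>0$ such that, as $L\to\infty$, $$\mathbb{P}(H(0)>L)=c_HL^{-\alpha_1(1+o(1))},\qquad \mathbb{P}(V(0)>L)=c_VL^{-\alpha_2(1+o(1))}.$$ Set $\varepsilon_i:=\frac12\left(\frac1{\alpha_i}-1\right)\vee0$ for $i=1,2$, and assume $\varepsilon_1\varepsilon_2<1$. Then, for $\mathbb{P}$-almost every environment $\omega$, the line-model random walk $X$ started from $0$ is conservative, i.e. for every $t<\infty$, $$P^\omega_0(\text{the number of jumps of }X\text{ in }[0,t]\text{ is finite})=1.$$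
   Context: Line model: for a realisation $\omega$ of $(H(k),V(k))_{k\in\mathbb{Z}}$, $X=(X_1,X_2)$ is the continuous-time random walk on $\mathbb{Z}^2$ with generator $\mathcal{L}^\omega f(x)=H(x_2)\,(f(x+e_1)-2f(x)+f(x-e_1))+V(x_1)\,(f(x+e_2)-2f(x)+f(x-e_2))$, $x=(x_1,x_2)\in\mathbb{Z}^2$, $e_1=(1,0)$, $e_2=(0,1)$; that is, it jumps from $x$ to each of $x\pm e_1$ at rate $H(x_2)$ and to each of $x\pm e_2$ at rate $V(x_1)$. $P^\omega_0$ denotes its (quenched) law started from $0$ in the fixed environment $\omega$; $\mathbb{P}$ is the law of the environment. $a\vee b=\max(a,b)$. *)

(* Defs.v *)
From HB Require Import structures.
From mathcomp Require Import all_boot all_order all_algebra finmap.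
From mathcomp Require Import all_classical all_reals all_analysis.

Set Implicit Arguments.
Unset Strict Implicit.
Unset Printing Implicit Defensive.

Import Order.TTheory GRing.Theory Num.Theory.
Import numFieldNormedType.Exports.

Local Open Scope classical_set_scope.
Local Open Scope ring_scope.

Section Independence.
Context (R : realType) (d : measure_display) (Omega : measurableType d).
Variable P : probability Omega R.

Definition mutually_independent (I : choiceType) (X : I -> {RV P >-> R}) : Prop :=
  forall (J : {fset I}) (A : I -> set R), (forall i, measurable (A i)) ->
    P (\bigcap_(i in [set` J]) (X i @^-1` A i)) =
    (\prod_(i <- J) P (X i @^-1` A i))%E.

Definition identically_distributed (I : Type) (X : I -> {RV P >-> R}) : Prop :=
  forall i j (A : set R), measurable A ->
    distribution P (X i) A = distribution P (X j) A.

Definition iid (I : choiceType) (X : I -> {RV P >-> R}) : Prop :=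
  mutually_independent X /\ identically_distributed X.

(* The members of the sigma-algebra generated by the family X. *)
Definition sigma_family (I : Type) (X : I -> {RV P >-> R}) : set (set Omega) :=
  <<s [set E | exists i, exists2 A : set R, measurable A & E = X i @^-1` A] >>.

Definition independent_families (I J : Type)
    (X : I -> {RV P >-> R}) (Y : J -> {RV P >-> R}) : Prop :=
  forall E F, sigma_family X E -> sigma_family Y F ->
    P (E `&` F) = (P E * P F)%E.

(* P(X > L) = c L^{- a (1 + o(1))} as L --> +oo *)
Definition power_tail (X : {RV P >-> R}) (c a : R) : Prop :=
  exists delta : R -> R, delta L @[L --> +oo] --> (0 : R) /\
    \forall L \near +oo,
      P [set w | L < X w] = (c * L `^ (- (a * (1 + delta L))))%:E.

End Independence.

Section MarkovChain.
Context (R : realType) (S : eqType).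

(* The rate from x to y read off a generator L: for y != x it is the jump rate,
   and for y = x it is minus the total rate out of x. *)
Definition rate (L : (S -> R) -> S -> R) (x y : S) : R :=
  L (fun z => (z == y)%:R) x.

Definition exit_rate (L : (S -> R) -> S -> R) (x : S) : R := - rate L x x.

Definition jump_prob (L : (S -> R) -> S -> R) (x y : S) : R :=
  if y == x then 0 else rate L x y / exit_rate L x.

(* Jump-chain/holding-time description of the (minimal, possibly explosive)
   continuous-time Markov chain with generator L started from x0: Y n is the
   state after n jumps and T n the time spent there. The identity
   chain_law says that Y is a Markov chain with transition probabilities
   jump_prob L and that, given Y, the T n are independent exponential variables
   with parameters exit_rate L (Y n); it determines the joint law of (Y, T). *)
Record is_markov_chain (L : (S -> R) -> S -> R) (x0 : S)
    (d : measure_display) (Omega : measurableType d) (P : probability Omega R)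
    (Y : nat -> Omega -> S) (T : nat -> {RV P >-> R}) : Prop := {
  chain_measurable : forall n y, measurable [set w | Y n w = y] ;
  chain_holding_gt0 : forall n w, 0 < T n w ;
  chain_law : forall (n : nat) (y : nat -> S) (s : nat -> R),
    (forall i, 0 <= s i) ->
    P [set w | forall i, (i <= n)%N -> Y i w = y i /\ s i < T i w] =
    ((y 0%N == x0)%:R * (\prod_(i < n) jump_prob L (y i) (y i.+1)) *
     \prod_(i < n.+1) expR (- (exit_rate L (y i) * s i)))%:E }.

Definition jump_time (Omega : Type) (T : nat -> Omega -> R) (n : nat) (w : Omega) : R :=
  \sum_(i < n) T i w.

(* Indices of the jumps made during [0, t]; the n-th jump (n >= 1) takes place
   at time jump_time T n. *)
Definition jumps_upto (Omega : Type) (T : nat -> Omega -> R) (t : R) (w : Omega) : set nat :=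
  [set n | (0 < n)%N /\ jump_time T n w <= t].

Definition conservative (L : (S -> R) -> S -> R) (x0 : S) : Prop :=
  forall (d : measure_display) (Omega : measurableType d) (P : probability Omega R)
    (Y : nat -> Omega -> S) (T : nat -> {RV P >-> R}),
  is_markov_chain L x0 Y T ->
  forall t : R, 0 <= t ->
    P [set w | finite_set (jumps_upto T t w)] = 1%E.

End MarkovChain.

Section LineModel.
Context (R : realType).

Definition e1 : int * int := (1, 0).
Definition e2 : int * int := (0, 1).

Definition line_generator (H V : int -> R) (f : int * int -> R) (x : int * int) : R :=
  H x.2 * (f (x + e1) - 2 * f x + f (x - e1)) +
  V x.1 * (f (x + e2) - 2 * f x + f (x - e2)).

End LineModel.

Definition eps (R : realType) (alpha : R) : R :=
  Num.max (2^-1 * (alpha^-1 - 1)) 0.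

(* Main.v *)
Require Import Defs.
From HB Require Import structures.
From mathcomp Require Import all_boot all_order all_algebra finmap.
From mathcomp Require Import all_classical all_reals all_analysis.
From mathcomp Require Import measurable_realfun ring lra zify.

(* Let [u x = E_x exp(- zeta)], where [zeta] is the explosion time in a fixed
   environment; [u] takes values in [[0, 1]], satisfies [L u = u], and the walk
   from 0 is conservative as soon as [u 0 = 0]. For a finitely supported [phi],
   summation by parts turns [L u = u] into the Caccioppoli inequality
     sum_x phi(x)^2 u(x)^2 <= sum over edges {x, y} of rate(x, y) (phi(y) - phi(x))^2.
   With [phi] a product of tents of half-widths [a] and [b], the right-hand side
   divided by [sum phi^2] is at most a constant times
     S_H(b) / (a^2 b) + S_V(a) / (a b^2),
   where [S_H(b)] and [S_V(a)] are the sums of H and V over the box. Only u at 0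
   matters, but the environment is stationary, so [E u(x)^2 = E u(0)^2] for all x
   and the average of [u^2] over the box has expectation [E u(0)^2]. Capping at 1
   and using [min(1, sum_k A_k) <= sum_k A_k^p], this expectation is at most
     C (b (a^2 b)^(-p1) + a (a b^2)^(-p2))   whenever E H^p1 and E V^p2 are finite.
   As [p_i] may be taken close to [1 / (1 + 2 eps_i)], the condition
   [eps_1 eps_2 < 1] is exactly what lets one pick [a = n^i], [b = n^j] with
   [eps_1 < i / j < 1 / eps_2], and then the bound tends to 0. *)

Set Implicit Arguments.
Unset Strict Implicit.
Unset Printing Implicit Defensive.

Import Order.TTheory GRing.Theory Num.Theory.
Import numFieldNormedType.Exports.

Local Open Scope classical_set_scope.
Local Open Scope ring_scope.

(** * Laplace transform of the explosion time and its energy estimate *)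

Section ExplosionTransform.
Context (R : realType).
Implicit Types (h v : int -> R) (x : int * int).

(* [jump_laplace h v n x] is E_x exp(- J_n), J_n the time of the n-th jump. *)
Fixpoint jump_laplace h v (n : nat) x : R :=
  if n is m.+1 then
    (h x.2 * (jump_laplace h v m (x + e1) + jump_laplace h v m (x - e1)) +
     v x.1 * (jump_laplace h v m (x + e2) + jump_laplace h v m (x - e2))) /
    (1 + 2 * (h x.2 + v x.1))
  else 1.

(** The jump times increase to the explosion time, so this limit is the transform of the latter.
    [limn] is a total operator; for nonnegative rates the sequence is nonincreasing and bounded
    below, so the limit is genuine. *)
Definition explosion_laplace h v x : R := limn (fun n => jump_laplace h v n x).

Lemma jump_laplaceS h v n x : jump_laplace h v n.+1 x =
  (h x.2 * (jump_laplace h v n (x + e1) + jump_laplace h v n (x - e1)) +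
   v x.1 * (jump_laplace h v n (x + e2) + jump_laplace h v n (x - e2))) /
  (1 + 2 * (h x.2 + v x.1)).
Proof. by []. Qed.

Lemma jump_laplace_ge0 h v n x :
  (forall k, 0 <= h k) -> (forall k, 0 <= v k) -> 0 <= jump_laplace h v n x.
Proof.
move=> h0 v0; elim: n x => [|n IH] x /=; first exact: ler01.
by rewrite divr_ge0 ?addr_ge0 ?mulr_ge0 ?addr_ge0.
Qed.

(** The one-step operator preserves order, so by induction only the first two terms have to be
    compared; there the total weight [2 (h + v) / (1 + 2 (h + v))] is at most 1. *)
Lemma jump_laplace_noninc h v n x :
  (forall k, 0 <= h k) -> (forall k, 0 <= v k) ->
  jump_laplace h v n.+1 x <= jump_laplace h v n x.
Proof.
move=> h0 v0; elim: n x => [|n IH] x; last first.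
  rewrite jump_laplaceS [leRHS]jump_laplaceS; apply: ler_pM => //.
  - by apply: addr_ge0; apply: mulr_ge0 => //; apply: addr_ge0; exact: jump_laplace_ge0.
  - by rewrite invr_ge0 addr_ge0// mulr_ge0// addr_ge0.
  - by apply: lerD; apply: ler_wpM2l => //; apply: lerD; exact: IH.
have := h0 x.2; have := v0 x.1; set a := v _; set b := h _ => a0 b0 /=.
by rewrite -/a -/b ler_pdivrMr; lra.
Qed.

Lemma jump_laplace_le1 h v n x :
  (forall k, 0 <= h k) -> (forall k, 0 <= v k) -> jump_laplace h v n x <= 1.
Proof.
move=> h0 v0; elim: n => [|n IH]; first by [].
exact: le_trans (jump_laplace_noninc _ _ h0 v0) IH.
Qed.

Lemma jump_laplace_cvg h v x :
  (forall k, 0 <= h k) -> (forall k, 0 <= v k) ->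
  jump_laplace h v n x @[n --> \oo] --> explosion_laplace h v x.
Proof.
move=> h0 v0; apply: nonincreasing_is_cvgn.
  by apply/nonincreasing_seqP => n; exact: jump_laplace_noninc.
by exists 0 => _ [n _ <-]; exact: jump_laplace_ge0.
Qed.

Lemma explosion_laplace_ge0 h v x :
  (forall k, 0 <= h k) -> (forall k, 0 <= v k) -> 0 <= explosion_laplace h v x.
Proof.
move=> h0 v0; apply: limr_ge; first by apply: cvgP; exact: (@jump_laplace_cvg h v x h0 v0).
by near=> n; exact: jump_laplace_ge0.
Unshelve. all: by end_near. Qed.

Lemma explosion_laplace_le1 h v x :
  (forall k, 0 <= h k) -> (forall k, 0 <= v k) -> explosion_laplace h v x <= 1.
Proof.
move=> h0 v0; apply: limr_le; first by apply: cvgP; exact: (@jump_laplace_cvg h v x h0 v0).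
by near=> n; exact: jump_laplace_le1.
Unshelve. all: by end_near. Qed.

(** Both sides of the recursion converge; clearing the positive denominator in the limit gives the
    eigenvalue equation. *)
Lemma explosion_laplace_eigen h v x :
  (forall k, 0 <= h k) -> (forall k, 0 <= v k) ->
  line_generator h v (explosion_laplace h v) x = explosion_laplace h v x.
Proof.
move=> h0 v0.
have cv y := @jump_laplace_cvg h v y h0 v0.
have d0 : 1 + 2 * (h x.2 + v x.1) != 0.
  by rewrite gt_eqF// ltr_pwDl// mulr_ge0// addr_ge0.
have cvS : jump_laplace h v n.+1 x @[n --> \oo] -->
  (h x.2 * (explosion_laplace h v (x + e1) + explosion_laplace h v (x - e1)) +
   v x.1 * (explosion_laplace h v (x + e2) + explosion_laplace h v (x - e2))) /
  (1 + 2 * (h x.2 + v x.1)).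
  under eq_fun do rewrite jump_laplaceS.
  apply: cvgM; last exact: cvg_cst.
  by apply: cvgD; apply: cvgM; do ?[exact: cvg_cst|exact: cvgD].
have cvx : jump_laplace h v n.+1 x @[n --> \oo] --> explosion_laplace h v x.
  by rewrite (cvg_shiftS (jump_laplace h v ^~ x)); exact: cv.
have E := cvg_unique (@Rhausdorff R) cvx cvS.
have := congr1 ( *%R^~ (1 + 2 * (h x.2 + v x.1))) (E _).
rewrite /= divfK// /line_generator => {}E.
apply/eqP; rewrite -subr_eq0; apply/eqP.
transitivity (h x.2 * (explosion_laplace h v (x + e1) + explosion_laplace h v (x - e1)) +
   v x.1 * (explosion_laplace h v (x + e2) + explosion_laplace h v (x - e2)) -
   explosion_laplace h v x * (1 + 2 * (h x.2 + v x.1))); first by ring.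
by rewrite E subrr.
Qed.

(** Moves the starting point into the environment, which is how stationarity of the environment
    later acts on the transform. *)
Lemma shift_jump_laplace h v n x y :
  jump_laplace h v n (x + y) =
  jump_laplace (fun k => h (k + y.2)) (fun k => v (k + y.1)) n x.
Proof.
elim: n x => [//|n IH] x /=.
by rewrite -!IH ![x + y + _]addrAC.
Qed.

Lemma shift_explosion_laplace h v y :
  explosion_laplace h v y =
  explosion_laplace (fun k => h (k + y.2)) (fun k => v (k + y.1)) (0, 0).
Proof.
by rewrite /explosion_laplace; congr (limn _); apply/funext => n;
   rewrite -shift_jump_laplace add0r.
Qed.

End ExplosionTransform.

(** * Caccioppoli inequality and tent cutoffs *)

Section Energy.
Context (R : realType).

Lemma abel_summation (f D : nat -> R) N :
  \sum_(i < N) f i.+1 * (D i.+1 - D i) =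
  f N * D N - f 0%N * D 0%N - \sum_(i < N) (f i.+1 - f i) * D i.
Proof.
elim: N => [|N IH]; first by rewrite !big_ord0; ring.
by rewrite !big_ord_recr /= IH; ring.
Qed.

(* Discretizes [\int phi^2 u u'' = \int u^2 phi'^2 - \int ((phi u)')^2]. *)
Lemma caccioppoli (g u : nat -> R) N :
  g 0%N = 0 -> g N = 0 -> (forall i, 0 <= u i <= 1) ->
  (forall i, (g i.+1 - g i) ^+ 2 <= 1) ->
  \sum_(i < N) g i.+1 ^+ 2 * u i.+1 * (u i.+2 - 2 * u i.+1 + u i) <= N%:R.
Proof.
move=> g0 gN u01 g1.
pose f i := g i ^+ 2 * u i; pose D i := u i.+1 - u i.
rewrite (eq_bigr (fun i : 'I_N => f i.+1 * (D i.+1 - D i))); last first.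
  by move=> i _; rewrite /f /D; ring.
rewrite abel_summation /f /D g0 gN expr0n /= !mul0r subr0 sub0r -sumrN.
rewrite -[leRHS](_ : \sum_(i < N) 1 = N%:R); last by rewrite sumr_const card_ord.
apply: ler_sum => i _.
have [/andP[u0 u1] /andP[w0 w1]] := (u01 i, u01 i.+1).
have := g1 i; set a := g i; set b := g i.+1; set p := u i; set q := u i.+1.
rewrite -/p in u0 u1; rewrite -/q in w0 w1 => ab1.
have -> : - ((b ^+ 2 * q - a ^+ 2 * p) * (q - p)) =
  p * q * (b - a) ^+ 2 - (b * q - a * p) ^+ 2 by ring.
apply: (@le_trans _ _ (p * q * (b - a) ^+ 2)).
  by rewrite lerBlDr lerDl sqr_ge0.
by apply: mulr_ile1 => //; [exact: mulr_ge0|exact: sqr_ge0|exact: mulr_ile1].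
Qed.

(** Subtraction on [nat] truncates, so the tent stays 0 beyond [2 * a] and the slope bound holds at
    every index. *)
Definition tent (a i : nat) : R := (minn i (2 * a - i))%:R.

Lemma tent_ge0 a i : 0 <= tent a i. Proof. exact: ler0n. Qed.

Lemma tent_le a i : tent a i <= a%:R.
Proof. rewrite ler_nat; lia. Qed.

Lemma tent0 a : tent a 0 = 0.
Proof. by rewrite /tent min0n. Qed.

Lemma tent_end a : tent a (2 * a) = 0.
Proof. by rewrite /tent subnn minn0. Qed.

Lemma tent_grad a i : (tent a i.+1 - tent a i) ^+ 2 <= 1.
Proof.
rewrite /tent; set m := minn _ _; set n := minn _ _.
have : m = n.+1 \/ m = n \/ n = m.+1 by rewrite /m /n; lia.
by case=> [->|[->|->]]; rewrite -?natr1; lra.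
Qed.

(** Keeps only the rising half, where the tent is [i.+1], and compares the sum of squares with a
    cube. *)
Lemma tent_sqr_sum a : a%:R ^+ 3 / 3 <= \sum_(i < 2 * a) tent a i.+1 ^+ 2.
Proof.
have le3 n : n%:R ^+ 3 / 3 <= \sum_(i < n) i.+1%:R ^+ 2 :> R.
  elim: n => [|n IH]; first by rewrite big_ord0 expr0n mul0r.
  rewrite big_ord_recr /=; apply: le_trans (lerD IH (lexx _)).
  by rewrite -natr1; have : 0 <= n%:R :> R by []; set r := n%:R => r0; nra.
apply: le_trans (le3 a) _.
rewrite mul2n -addnn big_split_ord /=.
rewrite -[leLHS]addr0; apply: lerD; last by apply: sumr_ge0 => i _; exact: sqr_ge0.
apply: ler_sum => i _; rewrite lerXn2r ?nnegrE//= /tent ler_nat.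
have := ltn_ord i; lia.
Qed.

(** The rate [h] is constant along a horizontal line and [v] along a vertical one, so each factors
    out of a one-dimensional sum to which [caccioppoli] applies. That sum contributes the line
    length [2 * a] or [2 * b]; the transverse tent is bounded by its height. *)
Lemma energy_bound (h v : int -> R) (u : int * int -> R) (a b : nat) :
  (forall k, 0 <= h k) -> (forall k, 0 <= v k) -> (forall x, 0 <= u x <= 1) ->
  (forall x, line_generator h v u x = u x) ->
  \sum_(i < 2 * a) \sum_(j < 2 * b) tent a i.+1 ^+ 2 * tent b j.+1 ^+ 2 *
     u (i.+1%:Z - a%:Z, j.+1%:Z - b%:Z) ^+ 2 <=
  2 * a%:R * b%:R ^+ 2 * \sum_(j < 2 * b) h (j.+1%:Z - b%:Z) +
  2 * b%:R * a%:R ^+ 2 * \sum_(i < 2 * a) v (i.+1%:Z - a%:Z).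
Proof.
move=> h0 v0 u01 Lu.
pose U (i j : nat) := u (i%:Z - a%:Z, j%:Z - b%:Z).
have UE i j : U i.+1 j.+1 =
   h (j.+1%:Z - b%:Z) * (U i.+2 j.+1 - 2 * U i.+1 j.+1 + U i j.+1) +
   v (i.+1%:Z - a%:Z) * (U i.+1 j.+2 - 2 * U i.+1 j.+1 + U i.+1 j).
  rewrite {1}/U -Lu /line_generator /= /U.
  have add p q p' q' : ((p, q) : int * int) + (p', q') = (p + p', q + q') by [].
  have opp p q : - ((p, q) : int * int) = (- p, - q) by [].
  rewrite /e1 /e2 !opp !add ?oppr0 ?addr0.
  by congr (_ * (u (_, _) - _ + u (_, _)) + _ * (u (_, _) - _ + u (_, _))); lia.
have U01 i j : 0 <= U i j <= 1 by exact: u01.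
(* One factor of [u ^+ 2] is replaced by [L u], which separates horizontal from vertical second
   differences. *)
rewrite (eq_bigr (fun i : 'I__ => \sum_(j < 2 * b) (
    h (j.+1%:Z - b%:Z) * tent b j.+1 ^+ 2 *
      (tent a i.+1 ^+ 2 * U i.+1 j.+1 * (U i.+2 j.+1 - 2 * U i.+1 j.+1 + U i j.+1)) +
    v (i.+1%:Z - a%:Z) * tent a i.+1 ^+ 2 *
      (tent b j.+1 ^+ 2 * U i.+1 j.+1 * (U i.+1 j.+2 - 2 * U i.+1 j.+1 + U i.+1 j)))));
  last first.
  move=> i _; apply: eq_bigr => j _; rewrite -/(U i.+1 j.+1) [U _ _ ^+ 2]expr2 {1}UE; ring.
under eq_bigr do rewrite big_split /=.
rewrite big_split /= exchange_big /=; apply: lerD.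
  rewrite mulr_sumr; apply: ler_sum => j _; rewrite -mulr_sumr.
  have cac := @caccioppoli (tent a) (U ^~ j.+1) (2 * a)
     (tent0 a) (tent_end a) (U01 ^~ j.+1) (tent_grad a).
  apply: le_trans (ler_wpM2l _ cac) _; first by rewrite mulr_ge0 ?sqr_ge0.
  rewrite (_ : _ * h _ = h (j.+1%:Z - b%:Z) * b%:R ^+ 2 * (2 * a)%:R); last first.
    by rewrite natrM; ring.
  rewrite ler_wpM2r// ler_wpM2l//.
  by rewrite lerXn2r ?nnegrE ?tent_ge0 ?tent_le.
rewrite mulr_sumr; apply: ler_sum => i _; rewrite -mulr_sumr.
have cac := @caccioppoli (tent b) (U i.+1) (2 * b)
   (tent0 b) (tent_end b) (U01 i.+1) (tent_grad b).
apply: le_trans (ler_wpM2l _ cac) _; first by rewrite mulr_ge0 ?sqr_ge0.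
rewrite (_ : _ * v _ = v (i.+1%:Z - a%:Z) * a%:R ^+ 2 * (2 * b)%:R); last first.
  by rewrite natrM; ring.
rewrite ler_wpM2r// ler_wpM2l//.
by rewrite lerXn2r ?nnegrE ?tent_ge0 ?tent_le.
Qed.

End Energy.

(** * Laplace transforms of the jump times *)

Section ExponentialTail.
Context (R : realType) (d : measure_display) (Omega : measurableType d).
Variable P : probability Omega R.
Local Notation mu := (@lebesgue_measure R).

Lemma integral_exponential_pdf_truncated (t : R) : 0 < t ->
  (\int[mu]_s (exponential_pdf 1 s * (s < t)%R%:R)%R%:E = (1 - expR (- t))%R%:E)%E.
Proof.
move=> t0.
have mpdf : measurable_fun setT (EFin \o (exponential_pdf 1 : R -> R)).
  by apply/measurable_EFinP; exact: measurable_exponential_pdf.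
transitivity (\int[mu]_(s in `[0%R, t[) (exponential_pdf 1 s)%R%:E)%E.
  rewrite [RHS]integral_mkcond; apply: eq_integral => s _.
  rewrite patchE; have [s0|s0] := leP 0 s; last first.
    by rewrite lt0_exponential_pdf// mul0r; case: ifP.
  have -> : (s \in [set` `[0, t[]) = (s < t).
    by apply/idP/idP; rewrite inE /= in_itv /= s0.
  by case: ifP; rewrite ?mulr1 ?mulr0.
rewrite integral_itv_bndo_bndc//; last exact: measurable_funS mpdf.
by have := exponential_prob_itv0c 1 t0; rewrite /exponential_prob => ->; rewrite mulN1r.
Qed.

(** Multiplied by [1 + q], the integrand is the exponential density of parameter [1 + q], whose
    integral is 1. *)
Lemma integral_exponential_pdf_laplace (q : R) : 0 <= q ->
  (\int[mu]_s (exponential_pdf 1 s * expR (- (q * s)))%R%:E = ((1 + q)^-1)%R%:E)%E.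
Proof.
move=> q0; have q1 : 0 < 1 + q by rewrite ltr_pwDl.
have := integral_exponential_pdf q1.
have -> : (\int[mu]_s (exponential_pdf (1 + q) s)%R%:E =
   \int[mu]_s ((1 + q)%R%:E * (exponential_pdf 1 s * expR (- (q * s)))%R%:E))%E.
  apply: eq_integral => s _; rewrite -EFinM; congr EFin.
  have [s0|s0] := leP 0 s; last by rewrite !lt0_exponential_pdf// mul0r mulr0.
  rewrite !exponential_pdfE// mul1r -expRD; congr (_ * expR _); ring.
rewrite ge0_integralZl_EFin//; last 3 first.
- by move=> s _; rewrite lee_fin mulr_ge0 ?expR_ge0// exponential_pdf_ge0.
- apply/measurable_EFinP; apply: measurable_funM.
    exact: measurable_exponential_pdf.
  by apply: measurableT_comp => //; apply: measurableT_comp => //; exact: measurable_funM.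
- exact: ltW.
move: (integral _ _ _) => [r| |]; last 2 first.
- by rewrite gt0_muley// lte_fin.
- by rewrite gt0_muleNy// lte_fin.
rewrite -EFinM => -[] qr; congr EFin.
by apply: (mulfI (lt0r_neq0 q1)); rewrite qr mulfV// lt0r_neq0.
Qed.

Lemma measurable_tail_indic (T : {RV P >-> R}) (s : R) :
  measurable_fun setT (fun w => (s < T w)%R%:R : R).
Proof.
by apply: measurableT_comp => //; apply: measurable_fun_ltr => //; exact: measurable_funPT.
Qed.

(** Writing [1 - exp(- T)] as the integral of [exp(- s)] over [0 <= s < T] and exchanging integrals
    gives [E[Z (1 - exp(- T))] = C / (1 + q)]; subtract this from [E Z = C]. The weight [Z] will
    hold the path event and the factors of the other holding times. *)
Lemma laplace_of_exponential_tail (Z : Omega -> R) (T : {RV P >-> R}) (C q : R) :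
  measurable_fun setT Z -> (forall w, 0 <= Z w) -> (forall w, 0 < T w) ->
  0 <= C -> 0 <= q ->
  (forall s : R, (0 <= s)%R ->
    (\int[P]_w (Z w * (s < T w)%R%:R)%R%:E = (C * expR (- (q * s)))%R%:E)%E) ->
  (\int[P]_w (Z w * expR (- T w))%R%:E = (C * (q / (1 + q)))%R%:E)%E.
Proof.
move=> mZ Z0 T0 C0 q0 tail.
have intZ : (\int[P]_w (Z w)%R%:E = C%:E)%E.
  have := tail 0 (lexx 0); rewrite mulr0 oppr0 expR0 mulr1 => <-.
  by apply: eq_integral => w _; rewrite T0 mulr1.
have mT : measurable_fun setT (T : Omega -> R) by exact: measurable_funPT.
have mE : measurable_fun setT (fun w => expR (- T w)).
  by apply: measurableT_comp => //; exact: measurableT_comp.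
have part : (\int[P]_w (Z w * (1 - expR (- T w)))%R%:E = (C / (1 + q))%R%:E)%E.
  pose F (ws : Omega * measurableTypeR R) : \bar R :=
    (Z ws.1 * ((ws.2 < T ws.1)%R%:R * exponential_pdf 1 ws.2))%R%:E.
  have F0 ws : (0 <= F ws)%E.
    by rewrite lee_fin !mulr_ge0// exponential_pdf_ge0.
  have mF : measurable_fun setT F.
    apply/measurable_EFinP; apply: measurable_funM; first exact: measurableT_comp.
    apply: measurable_funM; last first.
      by apply: measurableT_comp => //; exact: measurable_exponential_pdf.
    have -> : (fun ws : Omega * measurableTypeR R => (ws.2 < T ws.1)%R%:R : R) =
       (fun b : bool => b%:R : R) \o
       (fun ws : Omega * measurableTypeR R => (ws.2 : R) < T ws.1) by [].
    apply: measurableT_comp => //.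
    by apply: measurable_fun_ltr => //; exact: measurableT_comp.
  have := @fubini_tonelli _ _ _ _ _ P mu F mF F0.
  have -> : (\int[P]_w \int[mu]_s F (w, s) = \int[P]_w (Z w * (1 - expR (- T w)))%R%:E)%E.
    apply: eq_integral => w _; rewrite EFinM -integral_exponential_pdf_truncated//.
    rewrite -ge0_integralZl_EFin//.
    - by apply: eq_integral => s _; rewrite /F /= -EFinM [_ * exponential_pdf _ _]mulrC.
    - by move=> s _; rewrite lee_fin mulr_ge0// exponential_pdf_ge0.
    - apply/measurable_EFinP/measurable_funM; first exact: measurable_exponential_pdf.
      by apply: measurableT_comp => //; exact: measurable_fun_ltr.
  move=> ->.
  transitivity (\int[mu]_s (C%:E * (exponential_pdf 1 s * expR (- (q * s)))%R%:E))%E.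
    apply: eq_integral => s _; have [s0|s0] := leP 0 s; last first.
      rewrite lt0_exponential_pdf// mul0r mule0.
      by apply: integral0_eq => w _; rewrite /F /= lt0_exponential_pdf// !mulr0.
    rewrite -EFinM mulrCA EFinM -(tail _ s0) -ge0_integralZl_EFin//.
    - by apply: eq_integral => w _; rewrite /F /= -EFinM; congr EFin; ring.
    - by move=> w _; rewrite lee_fin mulr_ge0.
    - apply/measurable_EFinP/measurable_funM => //.
      by apply: measurableT_comp => //; exact: measurable_fun_ltr.
    - by rewrite exponential_pdf_ge0.
  rewrite ge0_integralZl_EFin// ?integral_exponential_pdf_laplace//.
  - by move=> s _; rewrite lee_fin mulr_ge0 ?expR_ge0// exponential_pdf_ge0.
  - apply/measurable_EFinP; apply: measurable_funM.
      exact: measurable_exponential_pdf.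
    by apply: measurableT_comp => //; apply: measurableT_comp => //; exact: measurable_funM.
have : (\int[P]_w (Z w * (1 - expR (- T w)))%R%:E + \int[P]_w (Z w * expR (- T w))%R%:E = C%:E)%E.
  rewrite -intZ -ge0_integralD//.
  - by apply: eq_integral => w _; rewrite -EFinD; congr EFin; ring.
  - move=> w _; rewrite lee_fin mulr_ge0// subr_ge0 -expR0 ler_expR oppr_le0.
    exact: ltW.
  - by apply/measurable_EFinP/measurable_funM => //; exact: measurable_funB.
  - by move=> w _; rewrite lee_fin mulr_ge0 ?expR_ge0.
  - by apply/measurable_EFinP/measurable_funM.
rewrite part; move: (integral _ _ _) => [r| |]//.
rewrite -EFinD => -[] Cr; congr EFin.
have q1 : 1 + q != 0 by rewrite gt_eqF// ltr_pwDl.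
have -> : r = C - C / (1 + q) by rewrite -[X in X - _]Cr addrAC subrr add0r.
by field.
Qed.

End ExponentialTail.

Definition path_event (S : eqType) (Omega : Type) (Y : nat -> Omega -> S)
    (n : nat) (y : nat -> S) : set Omega :=
  [set w | forall i, (i <= n)%N -> Y i w = y i].

(** * Jump times along a prescribed path *)

Section ChainLaplace.
Context (R : realType) (S : eqType) (L : (S -> R) -> S -> R) (x0 : S).
Context (d : measure_display) (Omega : measurableType d) (P : probability Omega R).
Variables (Y : nat -> Omega -> S) (T : nat -> {RV P >-> R}).
Hypothesis YT : is_markov_chain L x0 Y T.
Hypothesis jump_prob_ge0 : forall x y, 0 <= jump_prob L x y.
Hypothesis exit_rate_ge0 : forall x, 0 <= exit_rate L x.

Local Notation path_event := (path_event Y).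

Lemma path_event_measurable n y : measurable (path_event n y).
Proof.
rewrite (_ : path_event n y = \bigcap_(i < n.+1) [set w | Y i w = y i]); last first.
  by apply/seteqP; split => w h i /=; [move=> lin; exact: h|exact: h].
by apply: fin_bigcap_measurable => // i _; exact: (chain_measurable YT).
Qed.

Lemma jump_time_measurable n : measurable_fun setT (jump_time T n).
Proof. by apply: measurable_sum => i; exact: measurable_funPT. Qed.

Lemma jump_timeS n w : jump_time T n.+1 w = jump_time T n w + T n w.
Proof. by rewrite /jump_time big_ord_recr. Qed.

(** Interpolates between [chain_law] ([j = 0]) and the Laplace transform: the first [j] holding
    times already enter through [exp(- T i)], the others still through tail events. Each induction
    step converts one more tail by [laplace_of_exponential_tail]. *)
Lemma jump_time_laplace_path_tail n y j (s : nat -> R) :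
  (j <= n.+1)%N -> (forall i, 0 <= s i) ->
  (\int[P]_w (expR (- jump_time T j w) * (\1_(path_event n y) w *
       \prod_(j <= i < n.+1) (s i < T i w)%R%:R))%R%:E =
   (((y 0%N == x0)%:R * (\prod_(i < n) jump_prob L (y i) (y i.+1)) *
     \prod_(i < j) (exit_rate L (y i) / (1 + exit_rate L (y i)))) *
     \prod_(j <= i < n.+1) expR (- (exit_rate L (y i) * s i)))%R%:E)%E.
Proof.
elim: j s => [|j IH] s jn s0.
  rewrite big_ord0 mulr1 [in RHS]big_mkord -(chain_law YT n y s0).
  rewrite -[X in P X]setIT -integral_indic//; last first.
    rewrite (_ : [set w | _] = \bigcap_(i < n.+1) ([set w | Y i w = y i] `&`
        (T i : Omega -> R) @^-1` `]s i, +oo[)).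
      apply: fin_bigcap_measurable => // i _; apply: measurableI.
        exact: (chain_measurable YT).
      by rewrite -[X in measurable X]setTI; exact: measurable_funPT.
    apply/seteqP; split => w h i /=.
      by move=> lin; have [-> sT] := h i lin; split=> //=; rewrite in_itv/= andbT.
    by move=> lin; have [-> /=] := h i lin; rewrite in_itv/= andbT.
  apply: eq_integral => w _; congr EFin.
  rewrite /jump_time big_ord0 oppr0 expR0 mul1r big_mkord !indicE.
  have [hw|hw] := pselect (forall i, (i <= n)%N -> Y i w = y i /\ s i < T i w).
    rewrite !mem_set//; last by move=> i /hw[].
    by rewrite mul1r big1// => i _; have [_ ->] := hw i (ltn_ord i).
  rewrite [in RHS]memNset//.
  have [pw|pw] := pselect (path_event n y w); last by rewrite memNset// mul0r.
  have [i /not_implyP[lin sT]] : exists i, ~ ((i <= n)%N -> s i < T i w).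
    apply/existsNP => h; apply: hw => i lin; split; [exact: pw|exact: h].
  rewrite (bigD1 (Ordinal (lin : (i < n.+1)%N)))//=.
  by move/negP/negbTE: sT => ->; rewrite mul0r mulr0.
pose Z w := expR (- jump_time T j w) * (\1_(path_event n y) w *
       \prod_(j.+1 <= i < n.+1) (s i < T i w)%R%:R).
under eq_integral => w _.
  rewrite jump_timeS opprD expRD.
  rewrite (_ : _ * _ * _ = Z w * expR (- T j w)); last by rewrite /Z; ring.
  over.
rewrite (@laplace_of_exponential_tail _ _ _ _ Z (T j)
  ((y 0%N == x0)%:R * (\prod_(i < n) jump_prob L (y i) (y i.+1)) *
     \prod_(i < j) (exit_rate L (y i) / (1 + exit_rate L (y i))) *
     \prod_(j.+1 <= i < n.+1) expR (- (exit_rate L (y i) * s i)))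
  (exit_rate L (y j))) //.
- by rewrite big_ord_recr /=; congr EFin; ring.
- apply: measurable_funM.
    by apply: measurableT_comp => //; apply: measurableT_comp => //; exact: jump_time_measurable.
  apply: measurable_funM.
    by apply: measurable_indic; exact: path_event_measurable.
  apply: measurable_prod => i _.
  exact: measurable_tail_indic.
- move=> w; rewrite /Z !mulr_ge0 ?expR_ge0//.
  by apply: prodr_ge0 => i _.
- exact: (chain_holding_gt0 YT).
- rewrite !mulr_ge0//; apply: prodr_ge0 => i _ //; rewrite ?expR_ge0//.
  by rewrite divr_ge0// addr_ge0.
(* The tail of [T j] at an arbitrary level [r] comes from the induction hypothesis, which quantifies
   over all thresholds, with [s j] replaced by [r]. *)
- move=> r r0; pose s' i := if i == j then r else s i.
  have s'0 i : 0 <= s' i by rewrite /s'; case: ifP.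
  have s'E (G : nat -> R -> R) :
      \prod_(j <= i < n.+1) G i (s' i) = G j r * \prod_(j.+1 <= i < n.+1) G i (s i).
    rewrite big_ltn// /s' eqxx; congr (_ * _).
    by apply: eq_big_nat => i /andP[ji _]; rewrite gtn_eqF.
  have := IH s' (ltnW jn) s'0.
  rewrite (s'E (fun i t => expR (- (exit_rate L (y i) * t)))) => E.
  rewrite [X in _ = X%:E](_ : _ = (y 0%N == x0)%:R * (\prod_(i < n) jump_prob L (y i) (y i.+1)) *
     \prod_(i < j) (exit_rate L (y i) / (1 + exit_rate L (y i))) *
     (expR (- (exit_rate L (y j) * r)) *
      \prod_(j.+1 <= i < n.+1) expR (- (exit_rate L (y i) * s i)))); last by ring.
  rewrite -E; apply: eq_integral => w _; congr EFin.
  by rewrite (s'E (fun i t => (t < T i w)%R%:R)) /Z; ring.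
Qed.

Lemma jump_time_laplace_path n y :
  (\int[P]_w (expR (- jump_time T n w) * \1_(path_event n y) w)%R%:E =
   ((y 0%N == x0)%:R * \prod_(i < n) (jump_prob L (y i) (y i.+1) *
      (exit_rate L (y i) / (1 + exit_rate L (y i)))))%R%:E)%E.
Proof.
(* With [j = n] the only tail event left is [0 < T n], which always holds. *)
have := @jump_time_laplace_path_tail n y n (fun=> 0) (leqnSn n) (fun=> lexx 0).
rewrite big_nat1 mulr0 oppr0 expR0 mulr1 -mulrA -big_split /= => <-.
apply: eq_integral => w _; rewrite big_nat1 (chain_holding_gt0 YT) mulr1//.
Qed.

Lemma path_probability n y :
  (\int[P]_w (\1_(path_event n y) w)%R%:E =
   ((y 0%N == x0)%:R * \prod_(i < n) jump_prob L (y i) (y i.+1))%R%:E)%E.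
Proof.
have := @jump_time_laplace_path_tail n y 0 (fun=> 0) (leq0n _) (fun=> lexx 0).
rewrite big_ord0 mulr1 [X in _ * X]big1 ?mulr1; last first.
  by move=> i _; rewrite mulr0 oppr0 expR0.
move=> <-; apply: eq_integral => w _.
rewrite /jump_time big_ord0 oppr0 expR0 mul1r big1 ?mulr1// => i _.
by rewrite (chain_holding_gt0 YT).
Qed.

End ChainLaplace.

(** * The line-model chain and its jump times *)

Section LineChain.
Context (R : realType) (h v : int -> R).
Hypothesis h_gt0 : forall k, 0 < h k.
Hypothesis v_gt0 : forall k, 0 < v k.
Local Notation L := (line_generator h v).

Definition neighbours (x : int * int) := [:: x + e1; x - e1; x + e2; x - e2].

Lemma neighbours_neq x : x \notin neighbours x.
Proof.
have ne (e : int * int) : e != 0 -> (x == x + e) = false.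
  by apply: contraNF => /eqP xe; apply/eqP/(addrI x); rewrite addr0 -xe.
by rewrite /neighbours !in_cons !ne.
Qed.

Lemma neighbours_uniq x : uniq (neighbours x).
Proof. by rewrite /neighbours /= !in_cons !(inj_eq (addrI x)). Qed.

Lemma line_exit_rate x : exit_rate L x = 2 * (h x.2 + v x.1).
Proof.
have := neighbours_neq x; rewrite !inE !negb_or ![x == _]eq_sym.
case/and4P => /negbTE n1 /negbTE n2 /negbTE n3 /negbTE n4.
by rewrite /exit_rate /rate /line_generator n1 n2 n3 n4 eqxx /=; ring.
Qed.

Lemma line_exit_rate_gt0 x : 0 < exit_rate L x.
Proof. by rewrite line_exit_rate mulr_gt0// addr_gt0. Qed.

Lemma line_jump_prob_ge0 x y : 0 <= jump_prob L x y.
Proof.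
rewrite /jump_prob; case: (eqVneq y x) => // yx.
rewrite divr_ge0//; last exact/ltW/line_exit_rate_gt0.
rewrite /rate /line_generator [x == y]eq_sym (negbTE yx) mulr0 subr0.
by apply: addr_ge0; apply: mulr_ge0; rewrite ?addr_ge0//; exact/ltW.
Qed.

Lemma line_jump_prob_sum x (f : int * int -> R) :
  \sum_(z <- neighbours x) jump_prob L x z * f z =
  (h x.2 * (f (x + e1) + f (x - e1)) + v x.1 * (f (x + e2) + f (x - e2))) /
  (2 * (h x.2 + v x.1)).
Proof.
have d0 : 2 * (h x.2 + v x.1) != 0 by rewrite -line_exit_rate gt_eqF ?line_exit_rate_gt0.
have := neighbours_neq x; rewrite !inE !negb_or ![x == _]eq_sym.
case/and4P => /negbTE n1 /negbTE n2 /negbTE n3 /negbTE n4.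
rewrite /neighbours !big_cons big_nil /jump_prob n1 n2 n3 n4 line_exit_rate.
rewrite /rate /line_generator ![x == _]eq_sym n1 n2 n3 n4.
rewrite !(inj_eq (addrI x)) /=.
rewrite !mulr0n !mulr1n; field.
by move: d0; rewrite mulf_eq0 negb_or => /andP[].
Qed.

Context (d : measure_display) (Omega : measurableType d) (P : probability Omega R).
Variables (x0 : int * int) (Y : nat -> Omega -> int * int) (T : nat -> {RV P >-> R}).
Hypothesis YT : is_markov_chain L x0 Y T.

(** Induction on the number [m] of jumps still to come: the path event is split according to the
    next state, and the sum over the four neighbours reproduces the recursion of [jump_laplace].
    Working with whole paths takes the place of a Markov property. *)
Lemma line_laplace_path m n (y : nat -> int * int) :
  (\int[P]_w (expR (- jump_time T (n + m) w) * \1_(path_event Y n y) w)%R%:E <=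
   ((y 0%N == x0)%:R * (\prod_(i < n) (jump_prob L (y i) (y i.+1) *
      (exit_rate L (y i) / (1 + exit_rate L (y i))))) *
    jump_laplace h v m (y n))%R%:E)%E.
Proof.
have er0 x : 0 <= exit_rate L x by exact/ltW/line_exit_rate_gt0.
have mJ k : measurable_fun setT (fun w => expR (- jump_time T k w)).
  by apply: measurableT_comp => //; apply: measurableT_comp => //; exact: jump_time_measurable.
have mP k z : measurable_fun setT (\1_(path_event Y k z) : Omega -> R).
  by apply: measurable_indic; exact: (path_event_measurable YT).
have J0 k w : 0 <= jump_time T k w.
  by apply: sumr_ge0 => i _; exact/ltW/(chain_holding_gt0 YT).
have i0 k z w : 0 <= \1_(path_event Y k z) w :> R by rewrite indicE.
elim: m n y => [|m IH] n y.
  by rewrite addn0 (jump_time_laplace_path YT line_jump_prob_ge0 er0) mulr1.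
pose ext z i := if (i <= n)%N then y i else z.
have extE z i : (i <= n)%N -> ext z i = y i by rewrite /ext => ->.
have extS z : ext z n.+1 = z by rewrite /ext ltnn.
have ext_path z w : \1_(path_event Y n.+1 (ext z)) w =
    \1_(path_event Y n y) w * (Y n.+1 w == z)%:R :> R.
  rewrite !indicE -natrM mulnb; congr (nat_of_bool _)%:R.
  apply/idP/andP => [/set_mem pw|[/set_mem pw /eqP Yz]].
    split; first by apply/mem_set => i lin; rewrite pw ?extE// (leq_trans lin).
    by rewrite pw// extS.
  apply/mem_set => i; rewrite leq_eqVlt => /predU1P[->|]; first by rewrite extS.
  by rewrite ltnS => lin; rewrite extE// pw.
have prod_ext (G : int * int -> int * int -> R) z :
    \prod_(i < n.+1) G (ext z i) (ext z i.+1) =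
    (\prod_(i < n) G (y i) (y i.+1)) * G (y n) z.
  rewrite big_ord_recr /= extS extE//; congr (_ * _).
  by apply: eq_bigr => i _; rewrite !extE// ltnW.
(* The event of following the path and then leaving the neighbourhood; it must be shown to be
   null. *)
pose rest w : R := \1_(path_event Y n y) w * (Y n.+1 w \notin neighbours (y n))%:R.
have rest0 w : 0 <= rest w by rewrite mulr_ge0.
have split w : \1_(path_event Y n y) w =
    rest w + \sum_(z <- neighbours (y n)) \1_(path_event Y n.+1 (ext z)) w.
  under eq_bigr do rewrite ext_path.
  rewrite -mulr_sumr /rest -mulrDr -natr_sum -natrD.
  have -> : (\sum_(z <- neighbours (y n)) (Y n.+1 w == z) =
      (Y n.+1 w \in neighbours (y n)))%N.
    rewrite -(count_uniq_mem _ (neighbours_uniq (y n))) -sum1_count [RHS]big_mkcond /=.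
    by apply: eq_bigr => z _; rewrite /= eq_sym; case: eqP.
  by case: (_ \in _); rewrite mulr1.
have mrest : measurable_fun setT rest.
  rewrite (_ : rest = fun w => \1_(path_event Y n y) w -
      \sum_(z <- neighbours (y n)) \1_(path_event Y n.+1 (ext z)) w); last first.
    by apply/funext => w; rewrite split addrK.
  by apply: measurable_funB => //; apply: measurable_sum => z.
(* The four jump probabilities sum to 1, so the four extensions exhaust the probability of the
   path. *)
have irest : (\int[P]_w (rest w)%:E = 0)%E.
  have := path_probability YT line_jump_prob_ge0 er0 n y.
  rewrite (eq_integral (fun w => (rest w)%:E + \sum_(z <- neighbours (y n))
      (\1_(path_event Y n.+1 (ext z)) w)%:E)%E); last first.
    by move=> w _; rewrite split EFinD -sumEFin.
  rewrite ge0_integralD//; last 4 first.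
  - by move=> w _; rewrite lee_fin.
  - exact/measurable_EFinP.
  - by move=> w _; apply: sume_ge0 => z _; rewrite lee_fin.
  - by apply: emeasurable_sum => z; exact/measurable_EFinP.
  rewrite ge0_integral_sum//; last by move=> z; exact/measurable_EFinP.
  under eq_bigr => z _.
    rewrite (path_probability YT line_jump_prob_ge0 er0) prod_ext extE// mulrA.
    over.
  rewrite sumEFin -mulr_sumr.
  have -> : \sum_(z <- neighbours (y n)) jump_prob L (y n) z = 1.
    have := line_jump_prob_sum (y n) (fun=> 1); under eq_bigr do rewrite mulr1.
    move=> ->; field.
    by have := line_exit_rate_gt0 (y n); rewrite line_exit_rate pmulr_rgt0// => /lt0r_neq0.
  rewrite mulr1; move: (integral _ _ _) => [r| |]//.
  by rewrite -EFinD => -[] /(canRL (addrK _)); rewrite subrr => ->.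
rewrite [leLHS](_ : _ = (\int[P]_w ((expR (- jump_time T (n + m.+1) w) * rest w)%R%:E +
    \sum_(z <- neighbours (y n)) (expR (- jump_time T (n + m.+1) w) *
       \1_(path_event Y n.+1 (ext z)) w)%R%:E))%E); last first.
  apply: eq_integral => w _.
  by rewrite split mulrDr mulr_sumr EFinD -sumEFin.
rewrite ge0_integralD//; last 4 first.
- by move=> w _; rewrite lee_fin mulr_ge0 ?expR_ge0.
- by apply/measurable_EFinP; apply: measurable_funM.
- by move=> w _; apply: sume_ge0 => z _; rewrite lee_fin mulr_ge0 ?expR_ge0.
- by apply: emeasurable_sum => z; apply/measurable_EFinP; exact: measurable_funM.
rewrite (_ : (\int[P]_w (expR (- jump_time T (n + m.+1) w) * rest w)%:E = 0)%E); last first.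
  apply/eqP; rewrite eq_le; apply/andP; split; last first.
    by apply: integral_ge0 => w _; rewrite lee_fin mulr_ge0 ?expR_ge0.
  rewrite -irest; apply: ge0_le_integral => //.
  - by move=> w _; rewrite lee_fin mulr_ge0 ?expR_ge0.
  - by apply/measurable_EFinP; exact: measurable_funM.
  - exact/measurable_EFinP.
  - move=> w _; rewrite lee_fin ler_piMl// -expR0 ler_expR oppr_le0.
    exact: J0.
rewrite add0e ge0_integral_sum//; last first.
  by move=> z; apply/measurable_EFinP; exact: measurable_funM.
apply: le_trans.
  apply: lee_sum => z _; rewrite addnS -addSn; exact: IH.
under eq_bigr do rewrite (prod_ext (fun a b => jump_prob L a b * (exit_rate L a / (1 + exit_rate L a)))) extE// extS.
rewrite sumEFin lee_fin.
under eq_bigr => z _.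
  rewrite (_ : _ * _ * _ = ((y 0%N == x0)%:R *
     (\prod_(i < n) (jump_prob L (y i) (y i.+1) *
      (exit_rate L (y i) / (1 + exit_rate L (y i))))) *
     (exit_rate L (y n) / (1 + exit_rate L (y n)))) *
     (jump_prob L (y n) z * jump_laplace h v m z)); last by ring.
  over.
(* The discount [q / (1 + q)], with [q] the exit rate, cancels the denominator [q] of the jump
   probabilities and leaves the [1 + q] of [jump_laplace]. *)
rewrite -mulr_sumr line_jump_prob_sum jump_laplaceS line_exit_rate.
rewrite le_eqVlt -!mulrA; apply/orP; left; apply/eqP; congr (_ * (_ * _)).
field.
have a0 := h_gt0 (y n).2; have b0 := v_gt0 (y n).1.
by apply/andP; split; rewrite gt_eqF//; lra.
Qed.

Lemma line_laplace m :
  (\int[P]_w (expR (- jump_time T m w))%:E <= (jump_laplace h v m x0)%:E)%E.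
Proof.
have er0 x : 0 <= exit_rate L x by exact/ltW/line_exit_rate_gt0.
pose E := path_event Y 0 (fun=> x0).
have mE : measurable E by exact: (path_event_measurable YT).
have mJ : measurable_fun setT (fun w => expR (- jump_time T m w)).
  by apply: measurableT_comp => //; apply: measurableT_comp => //; exact: jump_time_measurable.
have PE : (P E = 1)%E.
  have := path_probability YT line_jump_prob_ge0 er0 0 (fun=> x0).
  by rewrite eqxx big_ord0 mulr1 integral_indic// setIT.
have := line_laplace_path m 0 (fun=> x0).
rewrite eqxx big_ord0 mulr1 mul1r add0n; apply: le_trans.
rewrite (@ge0_ae_eq_integral _ _ _ P setT _
  (fun w => (expR (- jump_time T m w) * \1_E w)%:E))//.
- exact/measurable_EFinP.
- by apply/measurable_EFinP/measurable_funM => //; exact: measurable_indic.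
- exists (~` E); split; first exact: measurableC.
    by have := probability_setC P mE; rewrite PE subee.
  move=> w /= nw Ew; apply: nw => _; rewrite indicE mem_set// mulr1//.
Qed.

(** Exponential Markov inequality: the indicator of [J <= t] is at most [exp(t - J)]. *)
Lemma line_jump_time_le m (t : R) :
  (P [set w | (jump_time T m w <= t)%R] <= (expR t * jump_laplace h v m x0)%:E)%E.
Proof.
have mJ : measurable_fun setT (jump_time T m : Omega -> R) by exact: jump_time_measurable.
have mE : measurable_fun setT (fun w => expR (- jump_time T m w)).
  by apply: measurableT_comp => //; apply: measurableT_comp.
have mA : measurable [set w | jump_time T m w <= t].
  rewrite -[X in measurable X]setTI; rewrite (_ : [set w | _] = jump_time T m @^-1` `]-oo, t]).
    exact: mJ.
  by apply/seteqP; split => w /=; rewrite in_itv.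
rewrite -[X in P X]setIT -integral_indic// EFinM.
apply: (@le_trans _ _ (\int[P]_w ((expR t)%:E * (expR (- jump_time T m w))%:E))%E).
  apply: ge0_le_integral => //.
  - by apply/measurable_EFinP; exact: measurable_indic.
  - by apply/measurable_EFinP/measurable_funM.
  - move=> w _; rewrite -EFinM lee_fin indicE -expRD.
    have [/set_mem /= jt|_] := boolP (w \in _); last exact: expR_ge0.
    by rewrite -expR0 ler_expR subr_ge0.
rewrite ge0_integralZl_EFin ?expR_ge0//; last exact/measurable_EFinP.
by rewrite lee_pmul2l ?lte_fin ?expR_gt0//; exact: line_laplace.
Qed.

End LineChain.

(** Infinitely many jumps before [t] force every jump time below [t], an event of probability at
    most [expR t * jump_laplace h v m x0] for each [m], and this tends to 0. *)
Lemma line_conservative (R : realType) (h v : int -> R) (x0 : int * int) :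
  (forall k, 0 < h k) -> (forall k, 0 < v k) -> explosion_laplace h v x0 = 0 ->
  conservative (line_generator h v) x0.
Proof.
move=> h0 v0 u0 d Omega P Y T YT t t0.
have nd w : nondecreasing_seq (jump_time T ^~ w).
  apply/nondecreasing_seqP => n.
  by rewrite jump_timeS lerDl; exact/ltW/(chain_holding_gt0 YT).
have mA m : measurable [set w | jump_time T m w <= t].
  rewrite -[X in measurable X]setTI; rewrite (_ : [set w | _] = (jump_time T m : Omega -> R) @^-1` `]-oo, t]).
    exact: jump_time_measurable.
  by apply/seteqP; split => w /=; rewrite in_itv.
pose A := \bigcap_m [set w | jump_time T m w <= t].
have mAA : measurable A by exact: bigcapT_measurable.
have -> : [set w | finite_set (jumps_upto T t w)] = ~` A.
  apply/seteqP; split => w /=.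
    move=> fin Aw; apply: infinite_nat.
    (* Index 0 never belongs to [jumps_upto], so it is adjoined before comparing with all of
       [nat]. *)
    have : finite_set (jumps_upto T t w `|` [set 0%N]) by rewrite finite_setU; split.
    apply: sub_finite_set => n _; have [->|n0] := posnP n; first by right.
    by left; split => //; exact: Aw.
  move=> nA; have [m mt] : exists m, ~ (jump_time T m w <= t).
    by apply/existsNP => le_t; apply: nA => m _; exact: le_t.
  apply: (@sub_finite_set _ _ `I_m); last exact: finite_II.
  move=> n [_ nt] /=; rewrite ltnNge; apply/negP => mn; apply: mt.
  exact: le_trans (nd w _ _ mn) nt.
rewrite probability_setC//.
suff -> : P A = 0%E by rewrite sube0.
apply/eqP; rewrite eq_le measure_ge0 andbT.
have cv : ((expR t * jump_laplace h v m x0)%:E @[m --> \oo] --> 0)%E.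
  apply: cvg_EFin; first by near=> m.
  rewrite -(mulr0 (expR t)) -u0; apply: cvgMr.
  by apply: jump_laplace_cvg => k; exact/ltW.
have <- := cvg_lim (@ereal_hausdorff R) cv.
apply: lime_ge; first exact: cvgP cv.
near=> m; apply: le_trans (line_jump_time_le h0 v0 YT m t).
by apply: le_measure; rewrite ?inE//; exact: bigcap_inf.
Unshelve. all: by end_near. Qed.

(** * Stationarity of the environment *)

Section Cylinder.
Context (R : realType) (I : choiceType).

Definition cylinders : set (set (I -> R)) :=
  [set E | exists J : {fset I}, exists2 A : I -> set R,
     (forall i, measurable (A i)) &
     E = \bigcap_(i in [set` J]) ((fun f => f i) @^-1` A i)].

Lemma cylinders_setI : setI_closed cylinders.
Proof.
move=> _ _ [J [A mA ->]] [K [B mB ->]].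
exists (J `|` K)%fset, (fun i => (if i \in J then A i else setT) `&`
                       (if i \in K then B i else setT)).
  by move=> i; apply: measurableI; case: ifP.
apply/seteqP; split=> f /=.
  move=> [fA fB] i /= _; split.
    by case: ifP => // iJ; exact: fA.
  by case: ifP => // iK; exact: fB.
move=> fAB; split=> i /= iJ.
  have [] := fAB i; first by rewrite /= inE iJ.
  by rewrite iJ.
have [] := fAB i; first by rewrite /= inE iJ orbT.
by rewrite iJ.
Qed.

Lemma cylinders_setT : cylinders setT.
Proof.
exists fset0, (fun=> setT) => //.
by apply/seteqP; split => // f _ i.
Qed.

(** The product sigma-algebra, presented by a generating pi-system so that a law is determined by
    its finite-dimensional rectangles. *)
Definition product_space := g_sigma_algebraType cylinders.

Lemma measurable_coordinate i :
  measurable_fun setT ((fun f => f i) : product_space -> R).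
Proof.
move=> _ A mA; rewrite setTI; apply: sub_sigma_algebra.
exists [fset i]%fset, (fun=> A) => //.
apply/seteqP; split=> f /=; first by move=> fA j /=; rewrite inE => /eqP ->.
by apply; rewrite /= inE.
Qed.

Context (d : measure_display) (Omega : measurableType d) (P : probability Omega R).

Definition joint (X : I -> {RV P >-> R}) (w : Omega) : product_space := fun i => X i w.

Lemma measurable_joint X : measurable_fun setT (joint X).
Proof.
apply: (@measurability _ _ Omega product_space setT (joint X) cylinders erefl).
move=> _ [_ [J [A mA ->]] <-]; rewrite setTI preimage_bigcap.
apply: fin_bigcap_measurable => // i _.
rewrite -[X in measurable X]setTI.
exact: (measurable_funPT (X i)).
Qed.

(** The two image measures agree on the pi-system of cylinders, hence everywhere; both integrals are
    then taken against the same law. *)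
Lemma joint_law_integral (X X' : I -> {RV P >-> R}) (F : product_space -> \bar R) :
  (forall (J : {fset I}) (A : I -> set R), (forall i, measurable (A i)) ->
    P (\bigcap_(i in [set` J]) (X i @^-1` A i)) =
    P (\bigcap_(i in [set` J]) (X' i @^-1` A i))) ->
  measurable_fun setT F -> (forall f, 0 <= F f)%E ->
  (\int[P]_w F (joint X w) = \int[P]_w F (joint X' w))%E.
Proof.
move=> XX' mF F0.
have mX := measurable_joint X; have mX' := measurable_joint X'.
have := @ge0_integral_pushforward _ _ _ _ _ _ mX P setT F measurableT mF (fun f _ => F0 f).
have := @ge0_integral_pushforward _ _ _ _ _ _ mX' P setT F measurableT mF (fun f _ => F0 f).
rewrite !preimage_setT => <- <-.
apply: eq_measure_integral => A mA _.
pose m1 : {measure set product_space -> \bar R} :=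
  measure_function_pushforward__canonical__measure_function_Measure P mX.
pose m2 : {measure set product_space -> \bar R} :=
  measure_function_pushforward__canonical__measure_function_Measure P mX'.
suff : m1 A = m2 A by [].
apply: (@measure_unique _ _ product_space cylinders (fun=> setT)) => //.
- exact: cylinders_setI.
- by move=> _; exact: cylinders_setT.
- by rewrite bigcup_const.
- move=> _ [J [B mB ->]]; rewrite /= /pushforward !preimage_bigcap; exact: XX'.
- move=> _; rewrite /= /pushforward preimage_setT probability_setT; exact: ltry.
Qed.

End Cylinder.

Section Stationarity.
Context (R : realType) (d : measure_display) (Omega : measurableType d).
Variable P : probability Omega R.

(** Reindexing by the translated set lets independence factor both sides, and the factors agree one
    by one. *)
Lemma iid_shift (X : int -> {RV P >-> R}) (s : int) (J : {fset int}) (A : int -> set R) :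
  iid X -> (forall i, measurable (A i)) ->
  P (\bigcap_(i in [set` J]) (X (i + s) @^-1` A i)) =
  P (\bigcap_(i in [set` J]) (X i @^-1` A i)).
Proof.
move=> [Xind Xid] mA.
pose K := [fset (i + s)%R | i in J]%fset.
have -> : \bigcap_(i in [set` J]) (X (i + s) @^-1` A i) =
          \bigcap_(k in [set` K]) (X k @^-1` A (k - s)).
  apply/seteqP; split=> w /= wA k /=.
    by move=> /imfsetP[i /= iJ ->]; rewrite addrK; exact: wA.
  by move=> kJ; have := wA (k + s); rewrite /= addrK; apply; apply/imfsetP; exists k.
rewrite !Xind// big_imfset /=; last by move=> i j _ _; exact: addIr.
apply: eq_bigr => i _; rewrite addrK.
exact: (Xid (i + s) i (A i) (mA i)).
Qed.

Lemma sigma_family_bigcap (X : int -> {RV P >-> R}) (f : int -> int)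
    (J : {fset int}) (A : int -> set R) :
  (forall i, measurable (A i)) ->
  sigma_family X (\bigcap_(i in [set` J]) (X (f i) @^-1` A i)).
Proof.
move=> mA; rewrite /sigma_family.
apply: (@fin_bigcap_measurable _ (g_sigma_algebraType
   [set E | exists i, exists2 A : set R, measurable A & E = X i @^-1` A])) => //.
by move=> i _; apply: sub_sigma_algebra; exists (f i), (A i).
Qed.

Variables (H V : int -> {RV P >-> R}).
Hypotheses (H_iid : iid H) (V_iid : iid V) (HV : independent_families H V).

(* The environment seen from [x]; the two families are indexed by [inl] and [inr]. *)
Definition environment (x : int * int) (k : int + int) : {RV P >-> R} :=
  match k with inl i => H (i + x.2) | inr i => V (i + x.1) end.

(** A cylinder splits into an [H] part and a [V] part; independence of the families factors its
    probability, and each factor is shifted separately. *)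
Lemma environment_stationary (x : int * int) (J : {fset int + int}) (A : int + int -> set R) :
  (forall i, measurable (A i)) ->
  P (\bigcap_(k in [set` J]) (environment x k @^-1` A k)) =
  P (\bigcap_(k in [set` J]) (environment (0, 0) k @^-1` A k)).
Proof.
move=> mA.
pose J1 := [fset i in pmap (fun k : int + int => if k is inl i then Some i else None) J]%fset.
pose J2 := [fset i in pmap (fun k : int + int => if k is inr i then Some i else None) J]%fset.
have J1P i : (i \in J1) = (inl i \in J).
  rewrite inE /= mem_pmap; apply/mapP/idP => [[k kJ]|iJ]; last by exists (inl i).
  by case: k kJ => // j jJ [->].
have J2P i : (i \in J2) = (inr i \in J).
  rewrite inE /= mem_pmap; apply/mapP/idP => [[k kJ]|iJ]; last by exists (inr i).
  by case: k kJ => // j jJ [->].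
have split z : \bigcap_(k in [set` J]) (environment z k @^-1` A k) =
   \bigcap_(i in [set` J1]) (H (i + z.2) @^-1` A (inl i)) `&`
   \bigcap_(i in [set` J2]) (V (i + z.1) @^-1` A (inr i)).
  apply/seteqP; split=> w /=.
    by move=> wA; split=> i /=; rewrite ?J1P ?J2P => iJ; exact: wA.
  move=> [wH wV] [i|i] /= iJ; first by apply: wH; rewrite /= J1P.
  by apply: wV; rewrite /= J2P.
rewrite !split HV; [|exact: sigma_family_bigcap..].
rewrite HV; [|exact: sigma_family_bigcap..].
rewrite (iid_shift _ _ H_iid) ?(iid_shift _ _ V_iid)//.
by congr (P _ * P _)%E; apply: eq_bigcapr => i _; rewrite addr0.
Qed.

(* Positive parts keep the rates nonnegative on the null set where [H] or [V]
   fails to be positive, so that no statement below is merely almost sure. *)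
Definition env_explosion_laplace (f : product_space R (int + int)%type) : R :=
  explosion_laplace (fun k => Num.max (f (inl k)) 0) (fun k => Num.max (f (inr k)) 0) (0, 0).

Lemma measurable_env_explosion_laplace : measurable_fun setT env_explosion_laplace.
Proof.
pose F n x (f : product_space R (int + int)%type) :=
  jump_laplace (fun k => Num.max (f (inl k)) 0) (fun k => Num.max (f (inr k)) 0) n x.
have mc k : measurable_fun setT ((fun f => Num.max (f k) 0) : product_space R (int + int)%type -> R).
  by apply: measurable_maxr => //; exact: measurable_coordinate.
have mF n : forall x, measurable_fun setT (F n x).
  elim: n => [|n IH] x; first exact: measurable_cst.
  rewrite /F /=; apply: measurable_funM; last first.
    (* The inverse is expressed as a real power so that [measurable_powR] applies. *)
    rewrite (_ : (fun f => _) = (fun f : product_space R (int + int)%type =>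
      (1 + 2 * (Num.max (f (inl x.2)) 0 + Num.max (f (inr x.1)) 0)) `^ (-1))); last first.
      by apply/funext => f; rewrite powR_inv1// addr_ge0// mulr_ge0// addr_ge0// le_max lexx orbT.
    apply: (measurableT_comp (measurable_powR (-1))).
    by apply: measurable_funD => //; apply: measurable_funM => //; exact: measurable_funD.
  by apply: measurable_funD; apply: measurable_funM => //; apply: measurable_funD; exact: IH.
apply: (@measurable_fun_cvg _ _ _ setT (fun n => F n (0, 0))) => // f _.
by apply: jump_laplace_cvg => k; rewrite le_max lexx orbT.
Qed.

Lemma explosion_laplace_stationary (x : int * int) :
  (\int[P]_w (explosion_laplace (fun k => Num.max (H k w) 0) (fun k => Num.max (V k w) 0) x ^+ 2)%:E =
   \int[P]_w (explosion_laplace (fun k => Num.max (H k w) 0) (fun k => Num.max (V k w) 0) (0, 0) ^+ 2)%:E)%E.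
Proof.
have E z w : explosion_laplace (fun k => Num.max (H k w) 0) (fun k => Num.max (V k w) 0) z =
    env_explosion_laplace (joint (environment z) w).
  by rewrite shift_explosion_laplace.
under eq_integral do rewrite E.
under [RHS]eq_integral do rewrite E.
apply: (@joint_law_integral _ _ _ _ P (environment x) (environment (0, 0))
  (fun f => (env_explosion_laplace f ^+ 2)%:E)).
- exact: environment_stationary.
- apply/measurable_EFinP; apply: measurable_funX.
  exact: measurable_env_explosion_laplace.
- by move=> f; rewrite lee_fin sqr_ge0.
Qed.

End Stationarity.

(** * Fractional moments of power tails *)

Section Moment.
Context (R : realType) (d : measure_display) (Omega : measurableType d).
Variable P : probability Omega R.

(** Absorbs the [o(1)]: once [delta L] is within [(a - p) / a] of 0, the exponent [a (1 + delta L)]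
    exceeds [p], and [1 <= L] orders the powers. *)
Lemma power_tail_bound (X : {RV P >-> R}) (c a p : R) :
  0 < c -> 0 < a -> p < a -> power_tail X c a ->
  exists2 B : R, 1 <= B & forall L, B <= L ->
    (P [set w | (L < X w)%R] <= (c * L `^ (- p))%:E)%E.
Proof.
move=> c0 a0 pa [delta [delta0 tailX]].
have e0 : 0 < (a - p) / a by rewrite divr_gt0// subr_gt0.
have /cvgrPdist_lt/(_ _ e0) near_delta := delta0.
have : \forall L \near +oo, 1 <= L /\ (P [set w | (L < X w)%R] <= (c * L `^ (- p))%:E)%E.
  near=> L; have L1 : 1 <= L by near: L; exact: nbhs_pinfty_ge.
  split => //.
  have -> : P [set w | L < X w] = (c * L `^ (- (a * (1 + delta L))))%:E by near: L.
  rewrite lee_fin ler_wpM2l ?(ltW c0)// ler_powR// lerN2.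
  have : `|0 - delta L| < (a - p) / a by near: L.
  rewrite sub0r normrN ltr_pdivlMr// => dL.
  have := ler_norm (- delta L); rewrite normrN => dL'; nra.
move=> [B [_ hB]]; exists (Num.max 1 (B + 1)); first by rewrite le_max lexx.
move=> L; rewrite ge_max => /andP[_ BL]; have ltL : B < L by lra.
by have [] := hB L ltL.
Unshelve. all: by end_near. Qed.

(** If [x <= B] the first term suffices. Otherwise take the least [k.+1] with [x <= B * 2 ^+ k.+1]:
    the [k]-th term of the series alone dominates. *)
Lemma dyadic_bound (B p x : R) : 1 <= B -> 0 < p -> 0 <= x ->
  ((x `^ p)%:E <= (B `^ p)%:E +
     \sum_(k <oo) ((B * 2 ^+ k.+1) `^ p * (B * 2 ^+ k < x)%R%:R)%R%:E)%E.
Proof.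
move=> B1 p0 x0.
have T0 k : (0 <= ((B * 2 ^+ k.+1) `^ p * (B * 2 ^+ k < x)%R%:R)%R%:E)%E.
  by rewrite lee_fin mulr_ge0 ?powR_ge0.
have [xB|Bx] := leP x B.
  apply: (@le_trans _ _ (B `^ p)%:E); last by rewrite leeDl// nneseries_ge0.
  by rewrite lee_fin ge0_ler_powR ?nnegrE ?(ltW p0)//; lra.
have ex : exists m, x <= B * 2 ^+ m.
  exists (Num.truncn x).+1; apply: (@le_trans _ _ (Num.truncn x).+1%:R).
    exact/ltW/truncnS_gt.
  apply: (@le_trans _ _ (2 ^+ (Num.truncn x).+1)); first by rewrite -natrX ler_nat ltnW// ltn_expl.
  by rewrite ler_peMl ?exprn_ge0.
case: (ex_minnP ex) => -[|k]; first by rewrite expr0 mulr1 leNgt Bx.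
move=> xk kmin.
have Bk : B * 2 ^+ k < x.
  by rewrite ltNge; apply/negP => /kmin; rewrite ltnn.
apply: (@le_trans _ _ (((B * 2 ^+ k.+1) `^ p * (B * 2 ^+ k < x)%R%:R)%R%:E)).
  rewrite Bk mulr1 lee_fin ge0_ler_powR ?nnegrE ?(ltW p0)// mulr_ge0 ?exprn_ge0//; lra.
apply: (@le_trans _ _ (\sum_(i <oo) ((B * 2 ^+ i.+1) `^ p * (B * 2 ^+ i < x)%R%:R)%R%:E)%E).
  apply: le_trans (@nneseries_lim_ge _ _ xpredT 0 k.+1 (fun n _ _ => T0 n)).
  by rewrite big_nat_recr//= leeDr// sume_ge0.
by rewrite leeDr// lee_fin powR_ge0.
Qed.

Lemma integral_tail_indic (X : {RV P >-> R}) (s : R) :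
  (\int[P]_w ((s < X w)%R%:R)%:E = P [set w | (s < X w)%R])%E.
Proof.
have mA : measurable [set w | s < X w].
  rewrite -[X in measurable X]setTI (_ : [set w | _] = (X : Omega -> R) @^-1` `]s, +oo[).
    exact: measurable_funPT.
  by apply/seteqP; split => w /=; rewrite in_itv/= andbT.
rewrite -[X in P X]setIT -integral_indic//; apply: eq_integral => w _.
rewrite indicE; congr ((nat_of_bool _)%:R%:E).
by apply/idP/idP => [sX|/set_mem//]; exact/mem_set.
Qed.

(** With [q] strictly between [p] and [a], the tail bound of exponent [q] makes the dyadic terms
    geometric of ratio [2 ^ (p - q) < 1]. *)
Lemma power_tail_moment (X : {RV P >-> R}) (c a p : R) :
  0 < c -> 0 < p < a -> power_tail X c a ->
  exists2 M : R, 0 <= M & (\int[P]_w ((Num.max (X w) 0) `^ p)%:E <= M%:E)%E.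
Proof.
move=> c0 /andP[p0 pa] tX.
pose q := (p + a) / 2.
have pq : p < q by rewrite /q; lra.
have qa : q < a by rewrite /q; lra.
have [B B1 tail] := power_tail_bound c0 (lt_trans p0 pa) qa tX.
pose r := 2 `^ (p - q) : R.
have r0 : 0 < r by exact: powR_gt0.
have r1 : r < 1.
  rewrite /r /powR gt_eqF// expR_lt1 nmulr_rlt0 ?subr_lt0//.
  by rewrite ln_gt0// ltr1n.
(* The bound on the dyadic term of index 0, hence the leading coefficient of the geometric
   majorant. *)
pose D := B `^ p * 2 `^ p * c * B `^ (- q).
have D0 : 0 <= D by rewrite !mulr_ge0 ?powR_ge0// ltW.
have B0 : 0 < B by lra.
exists (B `^ p + D * (1 - r)^-1).
  by rewrite addr_ge0 ?powR_ge0// mulr_ge0// invr_ge0 subr_ge0 ltW.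
have mX : measurable_fun setT (fun w => Num.max (X w) 0).
  by apply: measurable_maxr => //; exact: measurable_funPT.
pose t k w : R := (B * 2 ^+ k.+1) `^ p * (B * 2 ^+ k < X w)%R%:R.
have t0 k w : (0 <= (t k w)%:E)%E by rewrite lee_fin mulr_ge0 ?powR_ge0.
have mt k : measurable_fun setT (fun w => (t k w)%:E).
  by apply/measurable_EFinP; apply: measurable_funM => //; exact: measurable_tail_indic.
apply: (@le_trans _ _ (\int[P]_w ((B `^ p)%:E + \sum_(k <oo) (t k w)%:E))%E).
  apply: ge0_le_integral => //.
  - by move=> w _; rewrite lee_fin powR_ge0.
  - apply/measurable_EFinP; exact: (measurableT_comp (measurable_powR p)).
  - apply: emeasurable_funD => //; apply: ge0_emeasurable_sum => //.
  - move=> w _; have := @dyadic_bound B p (Num.max (X w) 0) B1 p0.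
    rewrite le_max lexx orbT => /(_ isT)/le_trans; apply.
    rewrite leeD2l//; apply: lee_nneseries => [k _ _|k _].
      by rewrite lee_fin mulr_ge0 ?powR_ge0.
    rewrite lee_fin /t lt_max [_ < 0]ltNge mulr_ge0 ?exprn_ge0 ?(ltW B0)//.
    by rewrite orbF.
rewrite ge0_integralD//; last 3 first.
- by move=> w _; rewrite lee_fin powR_ge0.
- by move=> w _; exact: nneseries_ge0.
- by apply: ge0_emeasurable_sum => // k w _ _; exact: t0.
have -> : (\int[P]_w (B `^ p)%:E = (B `^ p)%:E)%E.
  by rewrite integral_cst// -[RHS]mule1; congr (_ * _)%E; exact: probability_setT.
rewrite EFinD leeD2l//.
rewrite integral_nneseries//.
apply: lime_le; first by apply: is_cvg_nneseries => k _ _; exact: integral_ge0.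
near=> n.
apply: le_trans (_ : (series (geometric D r) n)%:E <= _)%E; last first.
  by rewrite lee_fin geometric_le_lim// gtr0_norm.
rewrite /series /= -sumEFin; apply: lee_sum => k _.
rewrite (_ : \int[P]_w _ = ((B * 2 ^+ k.+1) `^ p)%:E * P [set w | (B * 2 ^+ k < X w)%R])%E; last first.
  rewrite -integral_tail_indic -ge0_integralZl_EFin ?powR_ge0//.
  by apply/measurable_EFinP; exact: measurable_tail_indic.
have BL : B <= B * 2 ^+ k by rewrite ler_peMr ?(ltW B0)// exprn_ege1// ler1n.
apply: le_trans (lee_wpmul2l _ (tail _ BL)) _; first by rewrite lee_fin powR_ge0.
rewrite -EFinM lee_fin le_eqVlt; apply/orP; left; apply/eqP.
have e2 z : (2 ^+ k : R) `^ z = (2 `^ z) ^+ k.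
  by rewrite -powR_mulrn// -powRrM mulrC powRrM powR_mulrn ?powR_ge0.
rewrite exprSr !powRM ?exprn_ge0 ?mulr_ge0 ?(ltW B0)// !e2 /D /geometric /= /r.
rewrite powRD ?exprMn; last by apply/implyP.
ring.
Unshelve. all: by end_near. Qed.

(** Rests on [min(1, x) <= x ^ p] for [0 < p <= 1]: capping lets a fractional moment control
    variables of possibly infinite mean. *)
Lemma truncated_moment_bound (X : {RV P >-> R}) (p M s : R) :
  0 < p <= 1 -> 0 <= s -> (\int[P]_w ((Num.max (X w) 0) `^ p)%:E <= M%:E)%E ->
  (\int[P]_w (Num.min 1 (s * Num.max (X w) 0))%:E <= (s `^ p * M)%:E)%E.
Proof.
move=> /andP[p0 p1] s0 XM.
have mX : measurable_fun setT (fun w => Num.max (X w) 0).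
  by apply: measurable_maxr => //; exact: measurable_funPT.
have X0 w : 0 <= Num.max (X w) 0 by rewrite le_max lexx orbT.
apply: (@le_trans _ _ (\int[P]_w ((s `^ p)%:E * ((Num.max (X w) 0) `^ p)%:E))%E); last first.
  rewrite ge0_integralZl_EFin ?powR_ge0//.
  - by rewrite EFinM lee_wpmul2l// lee_fin powR_ge0.
  - by move=> w _; rewrite lee_fin powR_ge0.
  - apply/measurable_EFinP; exact: (measurableT_comp (measurable_powR p)).
apply: ge0_le_integral => //.
- by move=> w _; rewrite lee_fin le_min ler01 mulr_ge0.
- by apply/measurable_EFinP; apply: measurable_minr => //; exact: measurable_funM.
- apply/measurable_EFinP; apply: measurable_funM => //.
  exact: (measurableT_comp (measurable_powR p)).
- move=> w _; rewrite -EFinM lee_fin -powRM//.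
  have : 0 <= s * Num.max (X w) 0 by rewrite mulr_ge0.
  set x := s * _ => x0; have [x1|x1] := leP 1 x.
    have -> : 1 = 1 `^ p :> R by rewrite powR1.
    by rewrite ge0_ler_powR ?nnegrE// ltW.
  have [->|xn0] := eqVneq x 0; first by rewrite powR_ge0.
  rewrite -[leLHS]powRr1// ger_powR//.
  by rewrite lt0r xn0 x0 ltW.
Qed.

Lemma identically_distributed_integral (I : Type) (X : I -> {RV P >-> R}) i j (f : R -> \bar R) :
  identically_distributed X -> measurable_fun setT f -> (forall x, 0 <= f x)%E ->
  (\int[P]_w f (X i w) = \int[P]_w f (X j w))%E.
Proof.
move=> Xid mf f0.
have := ge0_integral_distribution (X i) mf f0.
have := ge0_integral_distribution (X j) mf f0.
move=> <- <-; apply: eq_measure_integral => A mA _; exact: Xid.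
Qed.

End Moment.

(** * Second moment of the explosion transform *)

Section EnergyAverage.
Context (R : realType).

Lemma min1D (x y : R) : 0 <= x -> 0 <= y ->
  Num.min 1 (x + y) <= Num.min 1 x + Num.min 1 y.
Proof.
move=> x0 y0; case: (leP 1 (x + y)); case: (leP 1 x); case: (leP 1 y); lra.
Qed.

Lemma min1_sum n (x : nat -> R) : (forall i, 0 <= x i) ->
  Num.min 1 (\sum_(i < n) x i) <= \sum_(i < n) Num.min 1 (x i).
Proof.
move=> x0; elim: n => [|n IH]; first by rewrite !big_ord0 ge_min lexx orbT.
rewrite !big_ord_recr /=; apply: le_trans (min1D _ _) _ => //.
  exact: sumr_ge0.
by rewrite lerD2r.
Qed.

Definition tent_mass (a : nat) : R := \sum_(i < 2 * a) tent R a i.+1 ^+ 2.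

(** The left side is at most the total mass because [u <= 1], and at most the energy; the minimum of
    the two is distributed over single rates by subadditivity of [min(1, _)]. The mass is at least
    [a^3 b^3 / 9], whence [18 = 2 * 9]. *)
Lemma energy_average_bound (h v : int -> R) (u : int * int -> R) (a b : nat) :
  (0 < a)%N -> (0 < b)%N ->
  (forall k, 0 <= h k) -> (forall k, 0 <= v k) -> (forall x, 0 <= u x <= 1) ->
  (forall x, line_generator h v u x = u x) ->
  \sum_(i < 2 * a) \sum_(j < 2 * b) tent R a i.+1 ^+ 2 * tent R b j.+1 ^+ 2 *
     u (i.+1%:Z - a%:Z, j.+1%:Z - b%:Z) ^+ 2 <=
  tent_mass a * tent_mass b *
    (\sum_(j < 2 * b) Num.min 1 (18 / (a%:R ^+ 2 * b%:R) * h (j.+1%:Z - b%:Z)) +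
     \sum_(i < 2 * a) Num.min 1 (18 / (b%:R ^+ 2 * a%:R) * v (i.+1%:Z - a%:Z))).
Proof.
move=> a0 b0 h0 v0 u01 Lu.
set E := \sum_(i < _) _; set SH := \sum_(j < _) Num.min _ _.
have EW : E <= tent_mass a * tent_mass b.
  rewrite /tent_mass mulr_suml; apply: ler_sum => i _.
  rewrite mulr_sumr; apply: ler_sum => j _.
  rewrite ler_piMr ?mulr_ge0 ?sqr_ge0//.
  by have /andP[u0 u1] := u01 (i.+1%:Z - a%:Z, j.+1%:Z - b%:Z); rewrite exprn_ile1.
have a1 : 0 < a%:R :> R by rewrite ltr0n.
have b1 : 0 < b%:R :> R by rewrite ltr0n.
have Wab : a%:R ^+ 3 * b%:R ^+ 3 / 9 <= tent_mass a * tent_mass b :> R.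
  rewrite (_ : _ / 9 = (a%:R ^+ 3 / 3) * (b%:R ^+ 3 / 3)); last by field.
  by apply: ler_pM; rewrite ?divr_ge0 ?exprn_ge0 ?tent_sqr_sum.
have W0 : 0 <= tent_mass a * tent_mass b.
  by apply: le_trans Wab; rewrite divr_ge0 ?mulr_ge0 ?exprn_ge0.
have := energy_bound a b h0 v0 u01 Lu; rewrite -/E.
set sH := \sum_(j < _) h _; set sV := \sum_(j < _) v _ => EE.
have sH0 : 0 <= sH by exact: sumr_ge0.
have sV0 : 0 <= sV by exact: sumr_ge0.
have s1 : 0 <= 18 / (a%:R ^+ 2 * b%:R) :> R by rewrite divr_ge0 ?mulr_ge0 ?exprn_ge0.
have s2 : 0 <= 18 / (b%:R ^+ 2 * a%:R) :> R by rewrite divr_ge0 ?mulr_ge0 ?exprn_ge0.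
have EW2 : E <= tent_mass a * tent_mass b *
    (18 / (a%:R ^+ 2 * b%:R) * sH + 18 / (b%:R ^+ 2 * a%:R) * sV).
  apply: le_trans EE _; apply: (@le_trans _ _ (a%:R ^+ 3 * b%:R ^+ 3 / 9 *
     (18 / (a%:R ^+ 2 * b%:R) * sH + 18 / (b%:R ^+ 2 * a%:R) * sV))).
    rewrite le_eqVlt; apply/orP; left; apply/eqP; field.
    by rewrite !gt_eqF.
  by rewrite ler_wpM2r// addr_ge0// mulr_ge0.
have : E <= tent_mass a * tent_mass b *
    Num.min 1 (18 / (a%:R ^+ 2 * b%:R) * sH + 18 / (b%:R ^+ 2 * a%:R) * sV).
  by rewrite minEle; case: ifP => _ //; rewrite mulr1.
move=> /le_trans; apply; rewrite ler_wpM2l//.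
apply: le_trans (min1D _ _) _; rewrite ?mulr_ge0//.
by apply: lerD; rewrite mulr_sumr; apply: (@min1_sum _ (fun i => _ * _ (i.+1%:Z - _))) => i;
  rewrite mulr_ge0.
Qed.

End EnergyAverage.

Section Expectation.
Context (R : realType) (d : measure_display) (Omega : measurableType d).
Variables (P : probability Omega R) (H V : int -> {RV P >-> R}).
Hypotheses (H_iid : iid H) (V_iid : iid V) (HV : independent_families H V).
Let h w k : R := Num.max (H k w) 0.
Let v w k : R := Num.max (V k w) 0.
Let u w x := explosion_laplace (h w) (v w) x.

Let h0 w k : 0 <= h w k. Proof. by rewrite le_max lexx orbT. Qed.
Let v0 w k : 0 <= v w k. Proof. by rewrite le_max lexx orbT. Qed.

Let u01 w x : 0 <= u w x <= 1.
Proof. by rewrite explosion_laplace_ge0 ?explosion_laplace_le1. Qed.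

Lemma measurable_explosion_laplace x : measurable_fun setT (u ^~ x).
Proof.
rewrite (_ : u ^~ x = fun w =>
    env_explosion_laplace (joint (environment H V x) w)); last first.
  by apply/funext => w; rewrite /u shift_explosion_laplace.
apply: measurableT_comp; first exact: measurable_env_explosion_laplace.
exact: measurable_joint.
Qed.

(** Takes expectations in [energy_average_bound]: stationarity turns the left side into the mass
    times the second moment at the origin, each capped rate is bounded through its fractional
    moment, and the mass cancels. *)
Lemma explosion_laplace_second_moment (p1 p2 M1 M2 : R) (a b : nat) :
  (0 < a)%N -> (0 < b)%N -> 0 < p1 <= 1 -> 0 < p2 <= 1 ->
  (\int[P]_w ((h w 0) `^ p1)%:E <= M1%:E)%E ->
  (\int[P]_w ((v w 0) `^ p2)%:E <= M2%:E)%E ->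
  (\int[P]_w (u w (0, 0) ^+ 2)%:E <=
   ((2 * b)%:R * ((18 / (a%:R ^+ 2 * b%:R)) `^ p1 * M1) +
    (2 * a)%:R * ((18 / (b%:R ^+ 2 * a%:R)) `^ p2 * M2))%:E)%E.
Proof.
move=> a0 b0 p1P p2P HM VM.
have a1 : 0 < a%:R :> R by rewrite ltr0n.
have b1 : 0 < b%:R :> R by rewrite ltr0n.
have s1 : 0 <= 18 / (a%:R ^+ 2 * b%:R) :> R by rewrite divr_ge0 ?mulr_ge0 ?exprn_ge0.
have s2 : 0 <= 18 / (b%:R ^+ 2 * a%:R) :> R by rewrite divr_ge0 ?mulr_ge0 ?exprn_ge0.
have m0 : 0 < tent_mass R a * tent_mass R b.
  by rewrite mulr_gt0// (lt_le_trans _ (tent_sqr_sum R _))// divr_gt0// exprn_gt0.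
have mmin s : measurable_fun [set: R] (fun x => (Num.min 1 (s * Num.max x 0))%:E).
  apply/measurable_EFinP; apply: measurable_minr => //.
  by apply: measurable_funM => //; exact: measurable_maxr.
have min0 s (x : R) : 0 <= s -> 0 <= Num.min 1 (s * Num.max x 0).
  by move=> s0; rewrite le_min ler01 mulr_ge0// le_max lexx orbT.
have mH s k : measurable_fun setT (fun w => (Num.min 1 (s * h w k))%:E).
  exact: (measurableT_comp (mmin s) (measurable_funPT (H k))).
have mV s k : measurable_fun setT (fun w => (Num.min 1 (s * v w k))%:E).
  exact: (measurableT_comp (mmin s) (measurable_funPT (V k))).
have intH k : (\int[P]_w (Num.min 1 (18 / (a%:R ^+ 2 * b%:R) * h w k))%:E <=
    ((18 / (a%:R ^+ 2 * b%:R)) `^ p1 * M1)%:E)%E.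
  apply: le_trans (truncated_moment_bound p1P s1 HM).
  rewrite (identically_distributed_integral k 0 (proj2 H_iid) (mmin _))//.
  by move=> x; rewrite lee_fin min0.
have intV k : (\int[P]_w (Num.min 1 (18 / (b%:R ^+ 2 * a%:R) * v w k))%:E <=
    ((18 / (b%:R ^+ 2 * a%:R)) `^ p2 * M2)%:E)%E.
  apply: le_trans (truncated_moment_bound p2P s2 VM).
  rewrite (identically_distributed_integral k 0 (proj2 V_iid) (mmin _))//.
  by move=> x; rewrite lee_fin min0.
pose phi (i j : nat) : R := tent R a i.+1 ^+ 2 * tent R b j.+1 ^+ 2.
have phi0 i j : 0 <= phi i j by rewrite mulr_ge0 ?sqr_ge0.
pose x i j : int * int := (i.+1%:Z - a%:Z, j.+1%:Z - b%:Z).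
have mu2 z : measurable_fun setT (fun w => (u w z ^+ 2)%:E).
  by apply/measurable_EFinP; apply: measurable_funX; exact: measurable_explosion_laplace.
have massE : tent_mass R a * tent_mass R b = \sum_(i < 2 * a) \sum_(j < 2 * b) phi i j.
  by rewrite /tent_mass mulr_suml; apply: eq_bigr => i _; rewrite mulr_sumr.
have lhs : (\int[P]_w (\sum_(i < 2 * a) \sum_(j < 2 * b) phi i j * u w (x i j) ^+ 2)%:E =
    (tent_mass R a * tent_mass R b)%:E * \int[P]_w (u w (0%R, 0%R) ^+ 2)%:E)%E.
  under eq_integral => w _.
    rewrite -sumEFin; under eq_bigr do rewrite -sumEFin.
    over.
  have m1 i j : measurable_fun setT (fun w => (phi i j * u w (x i j) ^+ 2)%:E).
    apply/measurable_EFinP; apply: measurable_funM => //.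
    by apply: measurable_funX; exact: measurable_explosion_laplace.
  have g0 i j w : (0 <= (phi i j * u w (x i j) ^+ 2)%:E)%E.
    by rewrite lee_fin mulr_ge0 ?sqr_ge0.
  rewrite ge0_integral_sum//; last 2 first.
  - by move=> i; apply: emeasurable_sum.
  - by move=> i w _; exact: sume_ge0.
  rewrite massE -sumEFin ge0_sume_distrl; last by move=> i _; rewrite lee_fin sumr_ge0.
  apply: eq_bigr => i _; rewrite ge0_integral_sum//.
  rewrite -sumEFin ge0_sume_distrl; last by move=> j _; rewrite lee_fin.
  apply: eq_bigr => j _; rewrite -(explosion_laplace_stationary H_iid V_iid HV (x i j)).
  rewrite -ge0_integralZl_EFin//; last exact: mu2.
  by move=> w _; rewrite lee_fin sqr_ge0.
set bound := (X in (_ <= X%:E)%E).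
suff : ((tent_mass R a * tent_mass R b)%:E * \int[P]_w (u w (0%R, 0%R) ^+ 2)%:E <=
    (tent_mass R a * tent_mass R b)%:E * bound%:E)%E.
  by rewrite lee_pmul2l// lte_fin.
rewrite -lhs.
apply: (@le_trans _ _ (\int[P]_w ((tent_mass R a * tent_mass R b)%:E *
    (\sum_(j < 2 * b) (Num.min 1 (18 / (a%:R ^+ 2 * b%:R) * h w (j.+1%:Z - b%:Z)))%:E +
     \sum_(i < 2 * a) (Num.min 1 (18 / (b%:R ^+ 2 * a%:R) * v w (i.+1%:Z - a%:Z)))%:E)))%E).
  apply: ge0_le_integral => //.
  - by move=> w _; rewrite lee_fin; apply: sumr_ge0 => i _; apply: sumr_ge0 => j _; rewrite mulr_ge0 ?sqr_ge0.
  - apply/measurable_EFinP; apply: measurable_sum => i; apply: measurable_sum => j.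
    apply: measurable_funM => //.
    by apply: measurable_funX; exact: measurable_explosion_laplace.
  - by apply: emeasurable_funM => //; apply: emeasurable_funD; apply: emeasurable_sum.
  - move=> w _; rewrite !sumEFin -EFinD -EFinM lee_fin.
    apply: energy_average_bound => // z; exact: explosion_laplace_eigen.
rewrite ge0_integralZl//; last 3 first.
- by apply: emeasurable_funD; apply: emeasurable_sum.
- by move=> w _; rewrite adde_ge0// sume_ge0// => i _; rewrite lee_fin min0.
- by rewrite lee_fin ltW.
rewrite lee_pmul2l//.
rewrite ge0_integralD//; last 4 first.
- by move=> w _; rewrite sume_ge0// => i _; rewrite lee_fin min0.
- exact: emeasurable_sum.
- by move=> w _; rewrite sume_ge0// => i _; rewrite lee_fin min0.
- exact: emeasurable_sum.
rewrite /bound EFinD; apply: leeD.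
  rewrite ge0_integral_sum//; last by move=> i w _; rewrite lee_fin min0.
  apply: le_trans (lee_sum _ (fun i _ => intH _)) _.
  by rewrite sumEFin sumr_const card_ord -[_ *+ (2 * _)]mulr_natl.
rewrite ge0_integral_sum//; last by move=> i w _; rewrite lee_fin min0.
apply: le_trans (lee_sum _ (fun i _ => intV _)) _.
by rewrite sumEFin sumr_const card_ord -[_ *+ (2 * _)]mulr_natl.
Qed.

End Expectation.

(** * Choice of exponents and box sizes *)

Section Scales.
Context (R : realType).

(** Adding the same [e <= 1] to both factors raises the product by at most [e (x + y + 1)], which
    the choice of [e] makes half of the gap [1 - x * y]. *)
Lemma enlarge_factors (x y : R) : 0 <= x -> 0 <= y -> x * y < 1 ->
  exists s t : R, [/\ x < s, y < t & s * t < 1].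
Proof.
move=> x0 y0 xy1; pose e := (1 - x * y) / (2 * (x + y + 1)).
have xy0 : 0 <= x * y by exact: mulr_ge0.
have D0 : 0 < 2 * (x + y + 1) by lra.
have e0 : 0 < e by rewrite divr_gt0// subr_gt0.
have eD : e * (2 * (x + y + 1)) = 1 - x * y by rewrite divfK// gt_eqF.
have e1 : e <= 1 by rewrite ler_pdivrMr//; lra.
exists (x + e), (y + e); split; rewrite ?ltrDl//.
have ee : e * e <= e by rewrite ler_piMl// ltW.
nra.
Qed.

(** A fraction [i / j] in the interval from [s] to [1 / t]: [j] is large enough that
    [t < j (1 - s t)], and [i] is the first integer above [s j]. *)
Lemma natural_ratio (s t : R) : 0 < s -> 0 < t -> s * t < 1 ->
  exists i j : nat, [/\ (0 < i)%N, (0 < j)%N, s * j%:R < i%:R & t * i%:R < j%:R].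
Proof.
move=> s0 t0 st1; have st : 0 < 1 - s * t by rewrite subr_gt0.
pose j := (Num.truncn (t / (1 - s * t))).+1; pose i := (Num.truncn (s * j%:R)).+1.
have jgt : t / (1 - s * t) < j%:R by exact: truncnS_gt.
have igt : s * j%:R < i%:R by exact: truncnS_gt.
have ile : i%:R <= s * j%:R + 1.
  by rewrite /i -natr1 lerD2r truncn_le// mulr_ge0// ltW.
exists i, j; split => //.
move: jgt; rewrite ltr_pdivrMr// => jgt.
apply: le_lt_trans (ler_wpM2l (ltW t0) ile) _; lra.
Qed.

Lemma powRN_small (k C e : R) : 0 < k -> 0 <= C -> 0 < e ->
  exists N : nat, forall n, (N < n)%N -> C * n%:R `^ (- k) <= e.
Proof.
move=> k0 C0 e0; exists (Num.truncn ((C / e) `^ k^-1)) => n Nn.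
have n0 : 0 < n%:R :> R by rewrite ltr0n (leq_ltn_trans _ Nn).
have Xn : (C / e) `^ k^-1 <= n%:R.
  apply: le_trans (ltW (truncnS_gt _)) _.
  by rewrite ler_nat.
rewrite powRN ler_pdivrMr ?powR_gt0// mulrC -ler_pdivrMr//.
have -> : C / e = ((C / e) `^ k^-1) `^ k.
  by rewrite -powRrM mulVf ?gt_eqF// powRr1// divr_ge0// ltW.
by rewrite ge0_ler_powR ?nnegrE ?powR_ge0// ltW.
Qed.

(** One of the two terms of the second-moment bound at [a = n ^ i], [b = n ^ j]; the other follows
    by exchanging [i] and [j]. *)
Lemma scale_power (n i j : nat) (p M : R) : (0 < n)%N ->
  (2 * n ^ j)%:R * ((18 / ((n ^ i)%:R ^+ 2 * (n ^ j)%:R)) `^ p * M) =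
  2 * 18 `^ p * M * n%:R `^ (- (p * (2 * i%:R + j%:R) - j%:R)).
Proof.
move=> n0; have n0' : n%:R != 0 :> R by rewrite pnatr_eq0 -lt0n.
rewrite natrM !natrX -exprM -exprD -!powR_mulrn//.
rewrite -powRN powRM ?powR_ge0// -powRrM opprB powRB; last by rewrite n0' implybT.
rewrite mulNr powRN natrD natrM.
rewrite (_ : (i%:R * 2 + j%:R) * p = p * (2 * i%:R + j%:R)); last by ring.
ring.
Qed.

Lemma second_moment_vanish (s t p1 p2 M1 M2 e : R) :
  0 < s -> 0 < t -> s * t < 1 -> p1 = (1 + 2 * s)^-1 -> p2 = (1 + 2 * t)^-1 ->
  0 <= M1 -> 0 <= M2 -> 0 < e ->
  exists a b : nat, [/\ (0 < a)%N, (0 < b)%N &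
   (2 * b)%:R * ((18 / (a%:R ^+ 2 * b%:R)) `^ p1 * M1) +
   (2 * a)%:R * ((18 / (b%:R ^+ 2 * a%:R)) `^ p2 * M2) <= e].
Proof.
move=> s0 t0 st1 p1E p2E M10 M20 e0.
have [i [j [i0 j0 sji tij]]] := natural_ratio s0 t0 st1.
(* For [p = 1 / (1 + 2 r)], positivity of the decay exponent [p (2 k + l) - l] is exactly
   [r l < k]. *)
have expo (r : R) (k l : nat) : 0 < r -> r * l%:R < k%:R ->
    0 < (1 + 2 * r)^-1 * (2 * k%:R + l%:R) - l%:R.
  move=> r0 rlk; have r1 : 0 < 1 + 2 * r by lra.
  rewrite subr_gt0 mulrC ltr_pdivlMr//; lra.
have k1 : 0 < p1 * (2 * i%:R + j%:R) - j%:R by rewrite p1E; exact: expo.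
have k2 : 0 < p2 * (2 * j%:R + i%:R) - i%:R by rewrite p2E; exact: expo.
have C1 : 0 <= 2 * 18 `^ p1 * M1 by rewrite !mulr_ge0 ?powR_ge0.
have C2 : 0 <= 2 * 18 `^ p2 * M2 by rewrite !mulr_ge0 ?powR_ge0.
have e2 : 0 < e / 2 by rewrite divr_gt0.
have [N1 h1] := powRN_small k1 C1 e2.
have [N2 h2] := powRN_small k2 C2 e2.
pose n := (maxn N1 N2).+1.
exists (n ^ i)%N, (n ^ j)%N; split; rewrite ?expn_gt0//.
rewrite !scale_power// [leRHS](splitr e); apply: lerD.
  by apply: h1; rewrite ltnS leq_maxl.
by apply: h2; rewrite ltnS leq_maxr.
Qed.

End Scales.

(** * Almost sure conservativeness *)

Lemma ae_forall_int (R : realType) (d : measure_display) (Omega : measurableType d)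
    (P : probability Omega R) (Q : int -> Omega -> Prop) :
  (forall k, {ae P, forall w, Q k w}) -> {ae P, forall w k, Q k w}.
Proof.
move=> aeQ.
have : {ae P, forall w (n : nat), if (choice.unpickle n : option int) is Some k then Q k w else True}.
  apply: ae_foralln => n; case: (choice.unpickle n) => [k|]; first exact: aeQ.
  exact: aeW.
by apply: filterS => w Qw k; have := Qw (choice.pickle k); rewrite choice.pickleK.
Qed.

(** Unfolding [eps], the inequality [(1 / alpha - 1) / 2 < s] says precisely that
    [1 / (1 + 2 s) < alpha], so the moment of that order is finite under a tail of exponent
    [alpha]. *)
Lemma eps_moment_exponent (R : realType) (alpha s : R) :
  0 < alpha -> eps alpha < s -> [/\ 0 < s, 0 < (1 + 2 * s)^-1 <= 1 & (1 + 2 * s)^-1 < alpha].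
Proof.
rewrite /eps gt_max => a0 /andP[sa s0]; have s1 : 0 < 1 + 2 * s by lra.
split => //; first by rewrite invr_gt0 s1 invf_le1//; lra.
by rewrite invf_plt ?posrE//; lra.
Qed.

Theorem proposition3p1 (R : realType) (d : measure_display)
    (Omega : measurableType d) (P : probability Omega R)
    (H V : int -> {RV P >-> R})
    (H_pos : forall k, {ae P, forall w, 0 < H k w})
    (V_pos : forall k, {ae P, forall w, 0 < V k w})
    (H_iid : iid H) (V_iid : iid V)
    (HV_indep : independent_families H V)
    (c : R) (c_gt0 : 0 < c)
    (H_ge : forall k, {ae P, forall w, c <= H k w})
    (V_ge : forall k, {ae P, forall w, c <= V k w})
    (alpha1 alpha2 cH cV : R)
    (alpha1_gt0 : 0 < alpha1) (alpha2_gt0 : 0 < alpha2)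
    (cH_gt0 : 0 < cH) (cV_gt0 : 0 < cV)
    (H_tail : power_tail (H 0) cH alpha1)
    (V_tail : power_tail (V 0) cV alpha2)
    (eps_lt1 : eps alpha1 * eps alpha2 < 1) :
  {ae P, forall w,
    conservative
      (line_generator (fun k : int => H k w) (fun k : int => V k w))
      ((0, 0) : int * int)}.
Proof.
have eps0 (x : R) : 0 <= eps x by rewrite le_max lexx orbT.
have [s [t [xs xt st1]]] := enlarge_factors (eps0 alpha1) (eps0 alpha2) eps_lt1.
have [s0 ps psa] := eps_moment_exponent alpha1_gt0 xs.
have [t0 pt pta] := eps_moment_exponent alpha2_gt0 xt.
have ps' : 0 < (1 + 2 * s)^-1 < alpha1 by rewrite psa andbT; case/andP: ps.
have pt' : 0 < (1 + 2 * t)^-1 < alpha2 by rewrite pta andbT; case/andP: pt.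
have [M1 M10 HM] := power_tail_moment cH_gt0 ps' H_tail.
have [M2 M20 VM] := power_tail_moment cV_gt0 pt' V_tail.
pose u w := explosion_laplace (fun k => Num.max (H k w) 0) (fun k => Num.max (V k w) 0) (0, 0).
have mu2 : measurable_fun setT (fun w => (u w ^+ 2)%:E).
  apply/measurable_EFinP; apply: measurable_funX.
  exact: measurable_explosion_laplace.
(* The second moment does not depend on the box, while suitable boxes bring its bound below any
   [e > 0]. *)
have u2 : (\int[P]_w (u w ^+ 2)%:E <= 0)%E.
  apply/lee_addgt0Pr => e e0; rewrite add0e.
  have [a [b [a0 b0 abe]]] := second_moment_vanish s0 t0 st1 erefl erefl M10 M20 e0.
  apply: le_trans (explosion_laplace_second_moment H_iid V_iid HV_indep a0 b0 ps pt HM VM) _.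
  by rewrite lee_fin.
have u0 : {ae P, forall w, u w = 0}.
  have : (\int[P]_w `|(u w ^+ 2)%:E| = 0)%E.
    apply/eqP; rewrite eq_le integral_ge0// andbT; apply: le_trans u2.
    under eq_integral do rewrite gee0_abs ?lee_fin ?sqr_ge0//.
    by [].
  move/(ae_eq_integral_abs P measurableT mu2).1; apply: filterS => w /(_ I).
  by move=> -[] /eqP; rewrite sqrf_eq0 => /eqP.
have Hp := ae_forall_int H_pos; have Vp := ae_forall_int V_pos.
(* On this almost sure event all rates are positive, so the positive parts in [u] coincide with [H]
   and [V]. *)
apply: filterS3 Hp Vp u0 => w Hw Vw uw.
apply: line_conservative => //.
rewrite -uw /u; congr (explosion_laplace _ _ _); apply/funext => k.
  by rewrite max_l// ltW.
by rewrite max_l// ltW.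
Qed.
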